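(* Let $q$ be an indeterminate and let $H_n(q)$ be the Hecke algebra over $\mathbb{Q}(q^{1/2})$ with generators $T_1,\dots,T_{n-1}$ and relations $(T_i+q)(T_i-1)=0$, $T_iT_j=T_jT_i$ for $|i-j|>1$, and $T_iT_{i+1}T_i=T_{i+1}T_iT_{i+1}$. Let $V_n$ be the $\mathbb{Q}(q^{1/2})$-vector space with basis $\{C_w:w\in I_n\}$. For $s=s_i$ write $T_s=T_i$, and define, for $w\in I_n$, $$\rho_q(T_s)C_w=\begin{cases}-qC_w,& sws=w\text{ and } s\in\mathrm{Des}(w),\\ C_w,& sws=w\text{ and } s\notin\mathrm{Des}(w),\\ (1-q)C_w+qC_{sws},& w<_I sws,\\ C_{sws},& sws<_I w.\end{cases}$$ Then (1) $\rho_q$ extends to a representation of $H_n(q)$ on $V_n$; and (2) this representation is equivalent to the multiplicity-free direct sum of all irreducible $H_n(q)$-representations (i.e. it is a Gelfand model for $H_n(q)$).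
   Context: $S=\{s_i=(i,i+1)\}$, $I_n$ is the set of involutions of $S_n$ (including the identity), $\ell$ is the Coxeter length, $s_i\in\mathrm{Des}(w)$ iff $w(i)>w(i+1)$. Involutive length: for $w\in I_n$ of cycle type $2^k1^{n-2k}$, $\hat\ell(w)=\min\{\ell(v): v\in S_n,\ w=v\,s_1s_3\cdots s_{2k-1}\,v^{-1}\}$. Involutive weak order $\le_I$ on $I_n$: the reflexive transitive closure of the relation $w\prec_I sws$ whenever $s\in S$ and $\hat\ell(sws)=\hat\ell(w)+1$; $<_I$ is its strict part. (Whenever $sws\neq w$, exactly one of $w<_I sws$, $sws<_I w$ holds.) *)

(* Defs.v *)
From HB Require Import structures.
From mathcomp Require Import all_boot all_order all_algebra all_fingroup.
From mathcomp Require Import fraction.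
Set Implicit Arguments. Unset Strict Implicit. Unset Printing Implicit Defensive.
Import Order.TTheory GRing.Theory Num.Theory.

Definition Fq : fieldType := {fraction {poly rat}}.
Definition qhalf : Fq := FracField.tofrac ('X : {poly rat}).
Definition q : Fq := (qhalf ^+ 2)%R.

Definition tpermn (n a b : nat) : 'S_n :=
  match insub a, insub b with
  | Some x, Some y => tperm x y
  | _, _ => 1%g
  end.

(* simple reflection s_{i+1} = (i+1, i+2) in 1-based notation, for i : 'I_(n-1);
   i.e. it swaps the 0-based positions i and i+1. *)
Definition sgen (n : nat) (i : 'I_n.-1) : 'S_n := tpermn n i i.+1.

Definition des (n : nat) (i : 'I_n.-1) (w : 'S_n) : bool :=
  match insub (i : nat), insub i.+1 with
  | Some x, Some y => (w y < w x)%N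
  | _, _ => false
  end.

Definition ell (n : nat) (v : 'S_n) : nat :=
  #|[set p : 'I_n * 'I_n | (p.1 < p.2)%N && (v p.2 < v p.1)%N]|.

Definition Inv (n : nat) := {w : 'S_n | (w * w == 1)%g}.

Definition ncyc2 (n : nat) (w : 'S_n) : nat := #|[set x : 'I_n | w x != x]|./2.

Definition wk (n k : nat) : 'S_n := (\prod_(j < k) tpermn n j.*2 j.*2.+1)%g.

(* involutive length: min { ell v : w = v (s_1 s_3 ... s_{2k-1}) v^{-1} }.
   In mathcomp, c ^ v = v^-1 * c * v, which as a function is v o c o v^-1.
   The default n*n is an upper bound for ell, so it never affects the min
   (the set is nonempty for involutions). *)
Definition ellI (n : nat) (w : 'S_n) : nat :=
  \big[minn/(n * n)%N]_(v : 'S_n | w == (wk n (ncyc2 w) ^ v)%g) ell v.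

Definition covI (n : nat) : rel (Inv n) := fun w u =>
  [exists i : 'I_n.-1,
     (val u == (val w ^ sgen i)%g) && (ellI (val u) == (ellI (val w)).+1)].

Definition leI (n : nat) (w u : Inv n) : bool := connect (@covI n) w u.
Definition ltI (n : nat) (w u : Inv n) : bool := (w != u) && leI w u.

(* a (finite-dimensional) representation of H_n(q) on F^d (row vectors,
   v |-> v *m A i is the action of T_{i+1}); the defining relations are
   palindromic, so row/column conventions are immaterial. *)
Definition is_hecke_rep (n d : nat) (A : 'I_n.-1 -> 'M[Fq]_d) : Prop :=
  [/\ forall i, ((A i + q%:M) *m (A i - 1%:M) = 0)%R,
      forall i j : 'I_n.-1, (i.+1 < j)%N || (j.+1 < i)%N ->
        (A i *m A j = A j *m A i)%R
    & forall i j : 'I_n.-1, (j : nat) = i.+1 ->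
        (A i *m A j *m A i = A j *m A i *m A j)%R].

Definition hecke_irr (n d : nat) (A : 'I_n.-1 -> 'M[Fq]_d) : Prop :=
  (0 < d)%N /\
  forall U : 'M[Fq]_d, (forall i, ((U *m A i)%R <= U)%MS) ->
    (\rank U = 0)%N \/ (\rank U = d)%N.

(* equivalence: an invertible intertwiner P (row_free & row_full forces d1 = d2) *)
Definition hecke_equiv (n d1 d2 : nat) (A : 'I_n.-1 -> 'M[Fq]_d1)
    (B : 'I_n.-1 -> 'M[Fq]_d2) : Prop :=
  exists P : 'M[Fq]_(d1, d2),
    [/\ row_free P, row_full P & forall i, (A i *m P = P *m B i)%R].

Definition Nn (n : nat) : nat := #|{: Inv n}|.

Definition rho_coef (n : nat) (i : 'I_n.-1) (w u : Inv n) : Fq :=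
  let sws := (val w ^ sgen i)%g in
  if sws == val w then
    (if des i (val w) then (if u == w then - q else 0)
     else (if u == w then 1 else 0))%R
  else if [exists w' : Inv n, (val w' == sws) && ltI w w'] then
    ((if u == w then 1 - q else 0) + (if val u == sws then q else 0))%R
  else if [exists w' : Inv n, (val w' == sws) && ltI w' w] then
    (if val u == sws then 1 else 0)%R
  else 0%R.

(* matrix of rho_q(T_{i+1}) : row a = image of basis vector C_{enum_val a} *)
Definition rho (n : nat) (i : 'I_n.-1) : 'M[Fq]_(Nn n) :=
  \matrix_(a, b) rho_coef i (enum_val a) (enum_val b).

(* Main.v *)
(** At [q = 1] the module is the space of involutions under conjugation,
    twisted by the sign [sg g w] counting the 2-cycles of [w] whose order is
    reversed by [g].  Any two involutions are exchanged by some permutation with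
    equal signs, or fixed by one with opposite signs; hence every matrix in the
    commutant is symmetric, the commutant is commutative and multiplicities are
    at most one.  Comparing restriction to [S_(n-1)] with the branching of
    involutions shows by induction that every irreducible character occurs,
    so the group algebra acts faithfully.

    For generic [q], rescaling [C_w] by powers of [qhalf] makes the [T_i]
    symmetric matrices over [Q(qhalf)], a field where a sum of squares vanishes
    only trivially: invariant subspaces have invariant orthogonal complements,
    which gives complete reducibility.  Specializing [qhalf] to 1 transfers two
    facts from [q = 1]: the commutant consists of symmetric matrices, so that no
    two summands are isomorphic, and the [n!] products [T_g], over one word for
    each permutation [g], are linearly independent.  Normal forms of words bound
    by [n!] the dimension of the algebra generated by any representation.  For
    the direct sum of the model with an irreducible [C], this expresses every
    [T_g T_i] through the [T_g] with the same coefficients in the model and in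
    [C]; the Gram matrix of the [T_g] in the model then yields a nonzero
    intertwiner from the model to [C]. *)

Require Import Defs.
From Stdlib Require Import Classical.
From HB Require Import structures.
From mathcomp Require Import all_boot all_order all_algebra all_fingroup.
From mathcomp Require Import all_field all_character.
From mathcomp Require Import fraction generic_quotient zify ring.

Set Implicit Arguments.
Unset Strict Implicit.
Unset Printing Implicit Defensive.
Import Order.TTheory GRing.Theory Num.Theory.

(** * The sign of a permutation on the 2-cycles of an involution *)

(** Two involutions give a graph on the points whose components are cycles and paths. A reflection
    of the component exchanges the two kinds of edges, except on a path with an even number of
    vertices: both its ends are fixed by the same involution, and its reversal preserves both kinds
    of edges while flipping only the middle edge. This is where the twist by [sg] acts, since that
    single edge makes the two signs differ.

    Specialization goes only from generic [qhalf] to 1, and it carries linear conditions: a nonzero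
    solution, scaled to polynomials not all divisible by ['X - 1], stays nonzero at 1. Hence both
    transferred facts are phrased as the absence of nonzero solutions, namely of an antisymmetric
    matrix in the commutant and of a linear relation among the [T_g]. Irreducibility is not of this
    kind, and an irreducible over [Q(qhalf)] is not known in advance to stay irreducible over larger
    fields. The generic part therefore replaces characters by orthogonality for the standard
    symmetric form. *)

Section Sign.
Local Open Scope group_scope.
Variable n : nat.
Implicit Types (g h w u : 'S_n) (x y : 'I_n).

Lemma mulg11P w : w * w = 1 -> involutive w.
Proof. by move=> ww x; rewrite -permM ww perm1. Qed.

Lemma conjpE w g x : (w ^ g) (g x) = g (w x).
Proof. by rewrite conjgE !permM permK. Qed.

Lemma conjg_inv w g : w * w = 1 -> w ^ g * w ^ g = 1.
Proof. by move=> ww; rewrite -conjMg ww conj1g. Qed.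

Definition sg g w : bool := \big[addb/false]_(x : 'I_n | x < w x) (g (w x) < g x).

(** [P] and [Q] each select one point of every 2-cycle of [w], and [G] is constant on 2-cycles. The
    partner of a point selected by [P] alone is selected by [Q] alone, so [w] matches the two
    remainders. *)
Lemma big_section w (P Q G : pred 'I_n) : involutive w ->
  (forall x, w x = x -> ~~ P x) -> (forall x, w x = x -> ~~ Q x) ->
  (forall x, w x != x -> P (w x) = ~~ P x) ->
  (forall x, w x != x -> Q (w x) = ~~ Q x) ->
  (forall x, w x != x -> G (w x) = G x) ->
  \big[addb/false]_(x | P x) G x = \big[addb/false]_(x | Q x) G x.
Proof.
move=> wK P0 Q0 PN QN GE.
rewrite (bigID Q) [RHS](bigID P) /=; congr addb.
  by apply: eq_bigl => x; rewrite andbC.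
rewrite (reindex_inj (inv_inj wK)) /=; apply: eq_big => x.
  case: (eqVneq (w x) x) => [e|ne]; last by rewrite PN // QN // negbK andbC.
  by rewrite e (negbTE (P0 _ e)) (negbTE (Q0 _ e)).
case: (eqVneq (w x) x) => [e|ne _]; last exact: GE.
by rewrite e (negbTE (P0 _ e)).
Qed.

Lemma addb_eq (a b : bool) : a (+) b = false -> a = b.
Proof. by case: a b => [] []. Qed.

Lemma neq_ltnN x y : x != y -> (y < x) = ~~ (x < y).
Proof. by rewrite -val_eqE /=; lia. Qed.

(** A pair is reversed by [g * h] when exactly one of the two stages reverses it. The 2-cycles of
    [w ^ g] come oriented by the order after [g]; [big_section] reorients them by the order before
    [g]. *)
Lemma sgM g h w : w * w = 1 -> sg (g * h) w = sg g w (+) sg h (w ^ g).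
Proof.
move=> /mulg11P wK.
have -> : sg h (w ^ g) =
    \big[addb/false]_(x : 'I_n | g x < g (w x)) (h (g (w x)) < h (g x)).
  rewrite /sg (reindex_inj (@perm_inj _ g)) /=.
  by apply: eq_big => x; rewrite conjpE.
have -> : \big[addb/false]_(x : 'I_n | g x < g (w x)) (h (g (w x)) < h (g x)) =
  \big[addb/false]_(x : 'I_n | x < w x) ((h (g (w x)) < h (g x)) (+) (g (w x) < g x)).
  rewrite [RHS](@big_section w _ (fun x => g x < g (w x))) //.
  - apply: eq_bigr => x lt.
    by rewrite [g (w x) < g x]ltnNge (ltnW lt) addbF.
  - by move=> x ->; rewrite ltnn.
  - by move=> x ->; rewrite ltnn.
  - by move=> x ne; rewrite wK -neq_ltnN // eq_sym.
  - by move=> x ne; rewrite wK -neq_ltnN // (inj_eq perm_inj) eq_sym.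
  - move=> x ne; rewrite wK [h (g x) < _]neq_ltnN ?(inj_eq perm_inj) //.
    by rewrite [g x < _]neq_ltnN ?(inj_eq perm_inj) // addNb addbN negbK.
rewrite big_split /= addbC -addbA addbb addbF.
by apply: eq_bigr => x _; rewrite !permM.
Qed.

Lemma sg1 w : sg 1 w = false.
Proof.
apply: big1 => x lt; apply/negbTE.
by rewrite !perm1 -leqNgt ltnW.
Qed.

Lemma sg_swap g w : g * g = 1 -> w * w = 1 -> sg g w = sg g (w ^ g).
Proof. by move=> gg ww; apply: addb_eq; rewrite -sgM // gg sg1. Qed.

Lemma sg_conj g h w : w * w = 1 -> w ^ g = w -> sg (g ^ h) (w ^ h) = sg g w.
Proof.
move=> ww wg; have := sgM g h ww; rewrite wg [g * h]conjgC sgM //.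
by move/eqP; rewrite addbC (inj_eq (can_inj (addbK _))) => /eqP.
Qed.

(** If [g] reverses a 2-cycle while mapping it to another one, it reverses the image too; these
    cancel in pairs under [x] to [g (w x)]. What remains are the 2-cycles whose two points [g]
    exchanges. *)
Lemma sg_flip g w : w * w = 1 -> g * g = 1 -> g * w = w * g ->
  sg g w = \big[addb/false]_(x : 'I_n | x < w x) (g x == w x).
Proof.
move=> /mulg11P wK /mulg11P gK cgw.
have cE x : w (g x) = g (w x) by rewrite -!permM cgw.
apply: addb_eq; rewrite -big_split /=.
pose Z x := [&& x < w x, g (w x) < g x & g x != w x].
transitivity (\big[addb/false]_(x | Z x) true).
  rewrite [RHS]big_mkcondr /=; apply: eq_bigr => x lt.
  case: eqP => [e|_]; rewrite ?andbF ?andbT ?addbF; last by case: ifP.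
  by rewrite -cE e wK lt.
rewrite (bigID (fun x => x < g (w x))) /=.
rewrite [X in _ (+) X](reindex (fun x => g (w x))) /=; last first.
  by exists (fun x => g (w x)) => x _; rewrite cE wK gK.
set A := (X in X (+) _); set B := (X in _ (+) X).
suff -> : A = B by rewrite addbb.
apply: eq_bigl => x; rewrite /Z !cE !wK !gK -!cE.
case: (eqVneq (g x) (w x)) => [-> |ne]; first by rewrite !andbF.
have neq : x != w (g x) by apply: contra ne => /eqP {2}->; rewrite wK.
by move: neq; rewrite -val_eqE /=; lia.
Qed.

End Sign.

(** * Exchanging two involutions *)

Section Swap.
Local Open Scope group_scope.
Variable n : nat.
Implicit Types (g h w u : 'S_n) (x y : 'I_n) (S : {set 'I_n}).

Lemma expg_fix (s : 'S_n) x i : ((s ^+ i) x == x) = (#|porbit s x| %| i).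
Proof.
set l := #|_|.
have l_gt0 : 0 < l by rewrite lt0n card_porbit_neq0.
have fixl k : (s ^+ (l * k)) x = x.
  elim: k => [|k IH]; first by rewrite muln0 expg0 perm1.
  by rewrite mulnS expgD permM [(s ^+ l) x]permX iter_porbit.
rewrite {1}(divn_eq i l) expgD permM mulnC fixl permX.
apply/eqP/eqP => [e|-> //].
have lt := ltn_pmod i l_gt0.
apply/eqP; rewrite -(nth_uniq x _ _ (uniq_traject_porbit s x)) ?size_traject //.
by rewrite !nth_traject //= e.
Qed.

Lemma expg_eq (s : 'S_n) x i j : (s ^+ i) x = (s ^+ (i + j)) x -> (s ^+ j) x = x.
Proof. by rewrite addnC expgD permM => /perm_inj. Qed.

(** The dichotomy of [swap_involutions] localized on a stable set [S], so that components can be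
    glued. In the second branch [g * g = 1] makes [g] carry [w'] back to [w] and gives equal signs
    through [sg_swap]. *)
Definition swaps w w' S g := perm_on S g /\
  ((g * w = w * g /\ g * w' = w' * g /\ sg g w (+) sg g w') \/
   (g * g = 1 /\ {in S, forall x, g (w x) = w' (g x)})).

Lemma swaps_sym w w' S g : swaps w w' S g -> swaps w' w S g.
Proof.
move=> [Sg gP]; split=> //.
case: gP => [[gw [gw' s]]|[gg gE]]; first by left; rewrite addbC.
right; split=> // x xS; have gK := mulg11P gg.
by rewrite -[w (g x)]gK gE ?perm_closed // gK.
Qed.

(* The orbits of [w' * w] are the components of the graph whose edges are the
   2-cycles of [w] and [w']: paths when they contain a fixed point. *)
Section Path.
Variables (w w' : 'S_n) (x0 : 'I_n).
Hypotheses (ww : w * w = 1) (ww' : w' * w' = 1) (fx0 : w' x0 = x0).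
Let c := w' * w.
Let O := porbit c x0.
Let l := #|O|.

Let cw' i : c ^+ i * w' * c ^+ i = w'.
Proof.
have cwc : c * w' * c = w'.
  by rewrite /c -!mulgA (mulgA w' w') ww' mul1g ww mulg1.
elim: i => [|i IH]; first by rewrite expg0 mulg1 mul1g.
transitivity (c ^+ i * (c * w' * c) * c ^+ i); last by rewrite cwc IH.
by rewrite {1}expgSr expgS !mulgA.
Qed.

Let wE : w = w' * c. Proof. by rewrite /c mulgA ww' mul1g. Qed.

Let cw'p i y : (c ^+ i) (w' ((c ^+ i) y)) = w' y.
Proof. by rewrite -!permM mulgA cw'. Qed.

Let w'p i : (c ^+ i) (w' ((c ^+ i) x0)) = x0.
Proof. by rewrite cw'p fx0. Qed.

Let Oc i y : ((c ^+ i) y \in O) = (y \in O).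
Proof. by rewrite /O -!eq_porbit_mem porbit_perm. Qed.

Let Ow' y : y \in O -> w' y \in O.
Proof. by move=> /porbitP[i ->]; rewrite -(Oc i) w'p porbit_id. Qed.

Let Ow y : y \in O -> w y \in O.
Proof. by move=> /Ow' yO; rewrite wE permM -[c]expg1 Oc. Qed.

Let Ol k y : y \in O -> (c ^+ (l * k)) y = y.
Proof.
move=> yO; apply/eqP; rewrite expg_fix.
by move: yO; rewrite -eq_porbit_mem => /eqP->; rewrite dvdn_mulr.
Qed.

Let nO u : involutive u -> (forall y, y \in O -> u y \in O) -> u \in 'N(O | 'P).
Proof.
move=> uK uO; apply/astabsP => y /=; rewrite apermE.
by apply/idP/idP => /uO //; rewrite uK.
Qed.

Lemma path_stable :
  (forall y, (w y \in O) = (y \in O)) /\ (forall y, (w' y \in O) = (y \in O)).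
Proof.
have wK := mulg11P ww; have wK' := mulg11P ww'.
by split=> y; apply/idP/idP; (try by move/Ow; rewrite ?wK); move/Ow'; rewrite ?wK'.
Qed.

(** Index [(c ^+ i) x0] by [i] modulo [l]: then [c], [w'], [w] act as [i + 1], [- i], [1 - i]. For
    odd [l] the reflection [k - i] with [2k = l + 1] exchanges [w] and [w']. For even [l = 2m] the
    half turn [c ^+ m] commutes with both and reverses the path. *)
Lemma swaps_path : exists g, swaps w w' O g.
Proof.
have wK := mulg11P ww; have wK' := mulg11P ww'.
have Nw := nO wK Ow; have Nw' := nO wK' Ow'.
have Nc : c \in 'N(O | 'P) by rewrite groupM.
have c1 y : y \in O -> c (w' (w y)) = y by rewrite permM wK' wK.
have rE u y : u \in 'N(O | 'P) -> y \in O -> restr_perm O u y = u y.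
  by move=> uN yO; rewrite restr_permE.
have rO u y : y \notin O -> restr_perm O u y = y.
  by move=> yO; rewrite (out_perm (restr_perm_on _ _)).
case lE: (odd l).
  pose k := l.+1./2; pose r := w' * c ^+ k.
  have Nr : r \in 'N(O | 'P) by rewrite groupM ?groupX.
  exists (restr_perm O r); split; first exact: restr_perm_on.
  right; split.
    rewrite -(@morphM _ _ _ (restr_perm_morphism O)) //= /r.
    by rewrite -mulgA (mulgA (c ^+ k)) cw' ww' morph1.
  move=> y yO; rewrite !rE ?Ow // /r !permM.
  apply: (@perm_inj _ (c ^+ k)); rewrite [RHS]cw'p wK' -permM -expgD.
  have -> : k + k = (l * 1).+1 by rewrite /k; lia.
  by rewrite expgS permM c1 // Ol.
pose m := l./2; have lm : l = m + m by rewrite /m; lia.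
pose g := restr_perm O (c ^+ m).
have m_gt0 : 0 < m by have := card_porbit_neq0 c x0; rewrite -/O -/l; lia.
have Ng : c ^+ m \in 'N(O | 'P) by rewrite groupX.
have gO y : y \in O -> g y = (c ^+ m) y by move=> yO; rewrite /g rE.
have gnO y : y \notin O -> g y = y by exact: rO.
have gg : g * g = 1.
  apply/permP => y; rewrite permM perm1.
  have [yO|yO] := boolP (y \in O); last by rewrite !gnO.
  by rewrite !gO ?Oc // -permM -expgD -lm -[l]muln1 Ol.
have gcw' : g * w' = w' * g.
  apply/permP => y; rewrite !permM.
  have [yO|yO] := boolP (y \in O); last first.
    by rewrite !gnO //; apply: contra yO => /Ow'; rewrite wK'.
  rewrite !gO ?Ow' //; apply: (@perm_inj _ (c ^+ m)).
  by rewrite cw'p -permM -expgD -lm -[l]muln1 Ol ?Ow'.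
have gcc : g * c = c * g.
  have: commute (restr_perm O c) c := restr_perm_commute _ _.
  rewrite /commute => e.
  have -> : g = restr_perm O c ^+ m by rewrite /g morphX.
  exact: (commuteX2 m 1 e).
have gcw : g * w = w * g.
  by rewrite wE mulgA gcw' -mulgA gcc mulgA.
exists g; split; first exact: restr_perm_on.
left; split=> //; split=> //.
rewrite !sg_flip //.
pose flip u := \big[addb/false]_(x : 'I_n | x < u x) (g x == u x).
(* One flipped point makes the parity odd: the indices of two flipped points differ by a multiple of
   [m], so they are the two ends of a single 2-cycle. *)
have fl_true u : involutive u ->
    (forall i y, (c ^+ i) (u ((c ^+ i) y)) = u y) ->
    (exists2 y, y \in O & g y = u y) -> flip u.
  move=> uK cu [y yO gy].
  have ne : y != g y.
    rewrite gO // eq_sym expg_fix; move: yO; rewrite -eq_porbit_mem => /eqP->.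
    by rewrite -/O -/l lm; apply/negP => /dvdn_leq; lia.
  have only x : x != u x -> g x = u x -> (x == y) || (x == g y).
    move=> nx e; have xO : x \in O by apply: contraR nx => xO; rewrite -e gnO.
    have /porbitP[i xE] : x \in porbit c y.
      by move: xO yO; rewrite -!eq_porbit_mem => /eqP-> /eqP->.
    have gciE k z : g ((c ^+ k) z) = (c ^+ k) (g z).
      by rewrite -!permM; congr fun_of_perm; apply/commute_sym/(commuteX k gcc).
    have: (c ^+ (i + i)) (g y) = g y.
      by rewrite expgD permM -gciE -xE e {1}xE cu gy.
    rewrite -gciE => /perm_inj/eqP.
    rewrite expg_fix; move: (yO); rewrite -eq_porbit_mem => /eqP->.
    rewrite -/O -/l lm => /dvdnP[k Ek].
    have {Ek} Ek : i = (m * k)%N by lia.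
    rewrite xE {}Ek (divn_eq k 2) modn2 mulnDr expgD permM.
    have -> : (m * (k %/ 2 * 2) = l * (k %/ 2))%N by lia.
    rewrite Ol //; case: (odd k); rewrite ?muln1 ?muln0 ?expg0 ?perm1 ?eqxx //.
    by rewrite gO // eqxx orbT.
  transitivity (\big[addb/false]_(x : 'I_n | (x < u x) && (g x == u x)) true).
    by rewrite big_mkcondr /=; apply: eq_bigr => x _; case: eqP.
  pose z := if y < u y then y else u y.
  rewrite (big_pred1 z) // => x /=.
  rewrite /z -gy; apply/andP/eqP => [[lt /eqP e]|].
    have /only : x != u x by rewrite -val_eqE neq_ltn lt.
    move=> /(_ e) /orP[] /eqP xE; move: lt; rewrite xE gy ?uK; first by move=> ->.
    by case: ltngtP.
  have ggy : g (g y) = y by rewrite -permM gg perm1.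
  case: ltngtP => [lt -> |lt -> |/val_inj/eqP]; last by rewrite (negbTE ne).
    by rewrite -gy lt.
  by rewrite (_ : u (g y) = y) ?ggy ?lt ?eqxx // gy uK.
have fl_false u : (forall y, y \in O -> g y <> u y) -> flip u = false.
  move=> none; apply: big1 => x lt; apply/negP => /eqP e.
  have [xO|xO] := boolP (x \in O); first exact: none xO e.
  by move: lt; rewrite -e gnO ?ltnn.
have cw i y : (c ^+ i) (w ((c ^+ i) y)) = w y.
  have wEp z : w z = c (w' z) by rewrite permM wK'.
  have ccE z : (c ^+ i) (c z) = c ((c ^+ i) z) by rewrite -!permM -expgS expgSr.
  by rewrite !wEp ccE cw'p.
have wx0 : w x0 = (c ^+ 1) x0 by rewrite expg1 /c permM fx0.
have flipE u e i : (forall k y, (c ^+ k) (u ((c ^+ k) y)) = u y) ->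
    u x0 = (c ^+ e) x0 ->
    g ((c ^+ i) x0) = u ((c ^+ i) x0) <-> (c ^+ (i + m + i)) x0 = (c ^+ e) x0.
  move=> cu ux0; rewrite gO ?mem_porbit // -ux0 -(cu i x0) !expgD !permM.
  by split=> [->|/perm_inj].
have x0O : x0 \in O by exact: porbit_id.
have Oi i : (c ^+ i) x0 \in O by exact: mem_porbit.
rewrite -/(flip w) -/(flip w').
(* In indices, [g] flips a 2-cycle of [w'] where [2i = m] modulo [2m], and one of [w] where
   [2i = 1 - m]. The parity of [m] decides which of the two is solvable. *)
case me: (odd m).
  rewrite fl_true ?fl_false // => [y /porbitP[i ->]|].
    rewrite (flipE w' 0) // ?fx0 ?expg0 ?perm1 //.
    by move/eqP; rewrite expg_fix -/O -/l lm => /dvdnP[k]; lia.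
  exists ((c ^+ m.+1./2) x0) => //.
  rewrite (flipE w 1%N) //; have -> : (m.+1./2 + m + m.+1./2 = 1 + l * 1)%N by lia.
  by rewrite addnC expgD permM Ol.
rewrite fl_false ?fl_true // => [|y /porbitP[i ->]].
  exists ((c ^+ m./2) x0) => //.
  rewrite (flipE w' 0) // ?fx0 ?expg0 ?perm1 //.
  have -> : (m./2 + m + m./2 = l * 1)%N by lia.
  by rewrite Ol.
rewrite (flipE w 1%N) // => e.
have {e} : (c ^+ 1) x0 = (c ^+ (l * 1 + (i + m + i))) x0.
  by rewrite expgD [RHS]permM Ol ?e.
have -> : (l * 1 + (i + m + i) = 1 + (l + (i + m + i)).-1)%N by lia.
by move/expg_eq/eqP; rewrite expg_fix -/O -/l lm => /dvdnP[k]; lia.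
Qed.

End Path.

Section Cycle.
Variables (w w' : 'S_n) (x0 : 'I_n).
Hypotheses (ww : w * w = 1) (ww' : w' * w' = 1).
Let c := w' * w.
Let P := porbit c x0.
Hypotheses (nfix : forall y, y \in P -> w y != y)
  (nfix' : forall y, y \in P -> w' y != y).

Let wK := mulg11P ww.
Let wK' := mulg11P ww'.
Let Pc y i : ((c ^+ i) y \in P) = (y \in P).
Proof. by rewrite /P -!eq_porbit_mem porbit_perm. Qed.

Let w'c y i : (c ^+ i) (w' ((c ^+ i) y)) = w' y.
Proof.
elim: i y => [|i IH] y; first by rewrite expg0 !perm1.
have cE z : c (w' (c z)) = w' z by rewrite !permM wK' wK.
by rewrite {1}expgSr expgS [LHS]permM (permM c) IH cE.
Qed.

(** On a cycle, [P] is every second vertex. If [w' y] were [(c ^+ i) y], a fixed point of [w'] (even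
    [i]) or of [w] (odd [i]) would sit halfway between them. *)
Let not_both y : y \in P -> w' y \notin P.
Proof.
move=> yP; apply/negP; rewrite -eq_porbit_mem => /eqP e.
have /porbitP[i Ei] : w' y \in porbit c y.
  by rewrite -eq_porbit_mem e eq_sym eq_porbit_mem.
pose z := (c ^+ i./2) y.
have zP : z \in P by rewrite Pc.
have : (c ^+ i./2) (w' z) = (c ^+ i./2) ((c ^+ (odd i + i./2)) y).
  by rewrite w'c Ei -permM -expgD -addnA addnn odd_double_half.
move=> /perm_inj; case: (odd i) => /= [|w'z]; last first.
  by move: (nfix' zP); rewrite w'z add0n eqxx.
rewrite add1n expgSr permM -/z => e1.
have /nfix/eqP[] : w' z \in P by rewrite e1 -[c]expg1 Pc.
by rewrite [RHS]e1 permM.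
Qed.

(** The component is a cycle on which [P] and its image under [w'] alternate. The reflection through
    the vertex [x0] exchanges the two kinds of edges: on [P] it is [j], which sends [(c ^+ i) x0] to
    [(c ^- i) x0], and on the other vertices [w'] followed by [j] and [w]. *)
Lemma swaps_cycle : exists2 O : {set 'I_n},
    [/\ x0 \in O, forall y, (w y \in O) = (y \in O),
        forall y, (w' y \in O) = (y \in O)
      & forall y, y \in O -> y \in P \/ w' y \in P] &
    (exists g, swaps w w' O g).
Proof.
have cE y : c y = w (w' y) by rewrite permM.
have cVE y : c^-1 y = w' (w y).
  by apply: (@perm_inj _ c); rewrite permKV cE wK' wK.
have cP y : (c y \in P) = (y \in P) by rewrite -[c]expg1 Pc.
have cVP y : (c^-1 y \in P) = (y \in P) by rewrite -[LHS]cP permKV.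
pose Q y := w' y \in P.
have PQ y : y \in P -> Q y = false by move/not_both/negbTE.
have QP y : Q y -> (y \in P) = false.
  by move=> Qy; apply/negP => /PQ; rewrite Qy.
have Qw y : Q (w y) = (y \in P) by rewrite /Q -cVE cVP.
have wPQ y : (w y \in P) = Q y by rewrite -{2}[y]wK Qw.
pose j y := if [pick i : 'I_(#|P|) | (c ^+ i) x0 == y] is Some i
  then (c ^- i) x0 else y.
have jE i : j ((c ^+ i) x0) = (c ^- i) x0.
  rewrite /j; case: pickP => [k /eqP e|none].
    apply: (@perm_inj _ (c ^+ i * c ^+ k)).
    have cc : c ^+ i * c ^+ k = c ^+ k * c ^+ i by rewrite -!expgD addnC.
    by rewrite {1}cc [LHS]permM [RHS]permM !permKV.
  have : (c ^+ i) x0 \in P by exact: mem_porbit.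
  rewrite porbit_traject => /trajectP[k lt e].
  by have /eqP[] := none (Ordinal lt); rewrite /= e permX.
have jP y : y \in P -> j y \in P.
  by move=> /porbitP[i ->]; rewrite jE -(Pc _ i) permKV porbit_id.
have jK y : y \in P -> j (j y) = y.
  move=> yP; move: (jP _ yP); case/porbitP: yP => i ->; rewrite jE.
  case/porbitP=> k e; rewrite e jE; apply: (@perm_inj _ (c ^+ k)).
  have cc : c ^+ i * c ^+ k = c ^+ k * c ^+ i by rewrite -!expgD addnC.
  by rewrite permKV -permM cc permM -e permKV.
have jc y : y \in P -> j (c y) = c^-1 (j y).
  case/porbitP => i ->; rewrite -permM -expgSr !jE.
  by rewrite expgS invMg permM.
have jcV y : y \in P -> j (c^-1 y) = c (j y).
  by move=> yP; rewrite -{2}[y](permKV c) jc ?cVP // permKV.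
pose g0 y := if y \in P then j y else if Q y then w (j (w' y)) else y.
have g0P y : y \in P -> g0 y = j y by rewrite /g0 => ->.
have g0Q y : Q y -> g0 y = w (j (w' y)) by move=> Qy; rewrite /g0 Qy QP.
have g0K : involutive g0.
  move=> y; have [yP|yP] := boolP (y \in P).
    by rewrite !g0P ?jP ?jK.
  have [yQ|yQ] := boolP (Q y); last by rewrite /g0 (negbTE yP) (negbTE yQ) (negbTE yP) (negbTE yQ).
  rewrite (g0Q y) // g0Q ?Qw ?jP //.
  have zP : w' y \in P by [].
  by rewrite -cVE jcV ?jP // jK // cE !wK' wK.
pose g := perm (inv_inj g0K).
exists (P :|: [set y | Q y]).
  split=> [|y|y|y]; rewrite ?inE; first by rewrite porbit_id.
  - by rewrite Qw wPQ orbC.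
  - by rewrite [Q (w' y)]/Q wK' orbC.
  by case/orP; [left|right].
exists g; split.
  apply/subsetP => y; rewrite inE permE; apply: contraR.
  by rewrite !inE negb_or /g0 => /andP[/negbTE-> /negbTE->].
right; split=> [|y].
  by apply/permP => y; rewrite permM perm1 !permE g0K.
rewrite !inE !permE => /orP[yP|yQ].
  by rewrite (g0P _ yP) g0Q ?Qw // -cVE jcV // cE wK.
by rewrite (g0Q _ yQ) g0P ?wPQ // -cVE -jc // cE wK'.
Qed.

End Cycle.
(** Components are peeled off one at a time. A permutation centralizing both involutions with
    opposite signs on one component settles all of [S], being the identity elsewhere; otherwise the
    exchanging involutions of [O] and [S :\: O] commute and are multiplied. *)
Lemma swaps_all w w' S : w * w = 1 -> w' * w' = 1 ->
  (forall x, (w x \in S) = (x \in S)) -> (forall x, (w' x \in S) = (x \in S)) ->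
  exists g, swaps w w' S g.
Proof.
move=> ww ww'; have wK := mulg11P ww; have wK' := mulg11P ww'.
have [m] := ubnP #|S|; elim: m S => // m IH S leS Sw Sw'.
have [->|/set0Pn[x0 x0S]] := eqVneq S set0.
  exists 1; split; first exact: perm_on1.
  by right; rewrite mul1g; split=> // x; rewrite inE.
suff [O [OS O0 Ow Ow'] [g gP]] : exists2 O : {set 'I_n},
    [/\ O \subset S, O != set0, forall y, (w y \in O) = (y \in O)
      & forall y, (w' y \in O) = (y \in O)] & (exists g, swaps w w' O g).
  have [|x|x|h hP] := IH (S :\: O).
  - have := proper_card (_ : S :\: O \proper S); move/(_ _)/leq_trans; apply=> //.
    rewrite properE subsetDl; case/set0Pn: O0 => x xO; apply/negP => /subsetP sub.
    by have := sub x (subsetP OS x xO); rewrite inE xO.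
  - by rewrite !inE Sw Ow.
  - by rewrite !inE Sw' Ow'.
  have [Og gcase] := gP; have [Sh hcase] := hP.
  have Sg : perm_on S g := subset_trans Og OS.
  have Sh' : perm_on S h := subset_trans Sh (subsetDl _ _).
  case: gcase => [gbad|[gg gE]]; first by exists g; split=> //; left.
  case: hcase => [hbad|[hh hE]]; first by exists h; split=> //; left.
  have cgh : commute g h.
    apply: (perm_onC Og Sh).
    by rewrite disjoint_sym disjoints_subset subsetDr.
  exists (g * h); split; first exact: perm_onM.
  right; split=> [|x xS].
    by rewrite {2}cgh mulgA -(mulgA g) hh mulg1 gg.
  have hO z : z \in O -> h z = z by move=> zO; rewrite (out_perm Sh) // inE zO.
  have [xO|xO] := boolP (x \in O); rewrite !permM.
    by rewrite gE // !hO ?Ow' ?perm_closed.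
  by rewrite !(out_perm Og) ?Ow // hE // inE xO.
have [/existsP[x0' /andP[x0'S fix0]]|nfix] :=
    boolP [exists x, (x \in S) && ((w x == x) || (w' x == x))].
  have path u u' y : u * u = 1 -> u' * u' = 1 ->
      (forall x, (u x \in S) = (x \in S)) -> (forall x, (u' x \in S) = (x \in S)) ->
      y \in S -> u' y = y ->
    exists2 O : {set 'I_n},
    [/\ O \subset S, O != set0, forall y, (u y \in O) = (y \in O)
      & forall y, (u' y \in O) = (y \in O)] & (exists g, swaps u u' O g).
    move=> uu uu' Su Su' yS fy; have [Ou Ou'] := path_stable uu uu' fy.
    exists (porbit (u' * u) y); last exact: swaps_path.
    split=> //; last by apply/set0Pn; exists y; apply: porbit_id.
    apply/subsetP => z /porbitP[i ->{z}]; elim: i => [|i IHi].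
      by rewrite expg0 perm1.
    by rewrite expgSr !permM Su Su'.
  case/orP: fix0 => /eqP fx; last exact: (path w w' x0').
  have [O [OS O0 Ow' Ow] [g gP]] := path w' w x0' ww' ww Sw' Sw x0'S fx.
  by exists O => //; exists g; apply: swaps_sym.
have orbS y : y \in porbit (w' * w) x0 -> y \in S.
  case/porbitP => i ->{y}; elim: i => [|i IHi]; first by rewrite expg0 perm1.
  by rewrite expgSr !permM Sw Sw'.
move: nfix; rewrite negb_exists => /forallP nfix.
have [||O [x0O Ow Ow' OS] gP] := @swaps_cycle w w' x0 ww ww'.
- by move=> y /orbS yS; have := nfix y; rewrite yS negb_or => /andP[].
- by move=> y /orbS yS; have := nfix y; rewrite yS negb_or => /andP[].
exists O => //; split=> //; last by apply/set0Pn; exists x0.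
apply/subsetP => y /OS[/orbS //|/orbS]; by rewrite Sw'.
Qed.

Lemma swap_involutions w w' (S : {set 'I_n}) : w * w = 1 -> w' * w' = 1 ->
  perm_on S w -> perm_on S w' ->
  exists2 g, perm_on S g & 
   [/\ w ^ g = w, w' ^ g = w' & sg g w (+) sg g w'] \/
   [/\ w ^ g = w', w' ^ g = w & sg g w = sg g w'].
Proof.
move=> ww ww' Sw Sw'.
have [x|x|g [Sg gP]] := swaps_all (S := S) ww ww'.
- exact: perm_closed.
- exact: perm_closed.
exists g => //; case: gP => [[gw [gw' s]]|[gg gE]].
  by left; split=> //; rewrite conjgE -?gw -?gw' mulKg.
have wg : w ^ g = w'.
  rewrite conjgE; apply/(canLR (mulKg _))/permP => x; rewrite !permM.
  have [xS|xS] := boolP (x \in S); first by rewrite gE.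
  by rewrite !(out_perm Sw) ?(out_perm Sg) // (out_perm Sw').
right; split=> //; last by rewrite sg_swap // wg.
by rewrite -wg -conjgM gg conjg1.
Qed.

End Swap.

(** * The model at q = 1 *)

Section SymmetricCommutant.
Local Open Scope group_scope.
Variables (n : nat) (R : numDomainType) (A : {set 'I_n}).
Variable a : 'S_n -> 'S_n -> R.
Hypothesis equiv_a : forall g w u : 'S_n, perm_on A g -> perm_on A w ->
  perm_on A u -> w * w = 1 -> u * u = 1 ->
  ((-1) ^+ sg g w * a (w ^ g) (u ^ g) = a w u * (-1) ^+ sg g u)%R.

(** If [g] exchanges [w] and [u], the equal signs cancel in the equivariance relation. If [g] fixes
    both with opposite signs, each entry equals its own opposite and both vanish. *)
Lemma equivariant_sym (w u : 'S_n) : perm_on A w -> perm_on A u ->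
  w * w = 1 -> u * u = 1 -> a w u = a u w.
Proof.
move=> Aw Au ww uu.
have [g Ag [[wg ug bad]|[wg ug good]]] := swap_involutions ww uu Aw Au; last first.
  have := equiv_a Ag Aw Au ww uu; rewrite wg ug good mulrC.
  by move/(mulIf _) => -> //; rewrite signr_eq0.
have zero v v' : v ^ g = v -> v' ^ g = v' -> sg g v (+) sg g v' ->
    perm_on A v -> perm_on A v' -> v * v = 1 -> v' * v' = 1 -> a v v' = 0%R.
  move=> vg v'g vv' Av Av' ev ev'.
  have := equiv_a Ag Av Av' ev ev'; rewrite vg v'g mulrC.
  rewrite (_ : sg g v = ~~ sg g v'); last by case: (sg g v) (sg g v') vv' => [] [].
  rewrite signrN mulrN => /eqP; rewrite eq_sym -addr_eq0 -mulr2n mulrn_eq0 /=.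
  by rewrite mulf_eq0 signr_eq0 orbF => /eqP.
by rewrite !zero // addbC.
Qed.

End SymmetricCommutant.

Section Reps.
Local Open Scope ring_scope.
Variables (n : nat).
Implicit Types (A B : {set 'I_n}) (g h w v : 'S_n).

(** Indexing by a subset [A] makes point stabilizers the groups [Sym (A :\ a)] of one ambient
    ['S_n], so the induction requires no embedding of smaller symmetric groups. *)
Definition invs A : {set 'S_n} := [set w in Sym A | w * w == 1]%g.

Lemma invsP A w : reflect (perm_on A w /\ (w * w = 1)%g) (w \in invs A).
Proof. by rewrite !inE; apply: (iffP andP) => [[-> /eqP]|[-> ->]]. Qed.

Definition sgc (g w : 'S_n) : algC := (-1) ^+ sg g w.

Definition inv_mx A g : 'M[algC]_#|invs A| :=
  \matrix_(i, j) if enum_val j == (enum_val i ^ g)%g then sgc g (enum_val i)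
                 else 0.

Lemma invsJ A w g : perm_on A g -> w \in invs A -> (w ^ g)%g \in invs A.
Proof.
move=> Ag; rewrite !inE -conjMg -(conj1g g) (inj_eq (@conjg_inj _ g)).
have gS : g \in Sym A by rewrite inE.
by have := memJ_conjg (Sym A) g w; rewrite conjGid // !inE => ->; rewrite conj1g.
Qed.

Lemma inv_mxl A g (X : 'M_#|invs A|) i j k :
    enum_val k = (enum_val i ^ g)%g ->
  (inv_mx A g *m X) i j = sgc g (enum_val i) * X k j.
Proof.
move=> ke; rewrite mxE (bigD1 k) //= mxE ke eqxx big1 ?addr0 // => l ne.
rewrite mxE; case: eqP => [e|_]; last by rewrite mul0r.
by rewrite -ke in e; rewrite (enum_val_inj e) eqxx in ne.
Qed.

Lemma inv_mx_repr A : mx_repr (Sym_group A) (inv_mx A).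
Proof.
split=> [|g h]; first apply/matrixP => i j.
  rewrite !mxE conjg1 /sgc sg1 expr0 (inj_eq enum_val_inj) eq_sym.
  by case: eqP.
rewrite !inE => Ag Ah; apply/matrixP => i j.
have wI := invsJ Ag (enum_valP i).
rewrite (inv_mxl _ _ (enum_rankK_in (enum_valP i) wI)).
rewrite !mxE enum_rankK_in // conjgM.
have [_ ww] := invsP _ _ (enum_valP i).
case: eqP => _; last by rewrite mulr0.
by rewrite /sgc sgM // signr_addb.
Qed.

Definition inv_repr A := MxRepresentation (inv_mx_repr A).
Definition invc A g : algC := \sum_(w in invs A | (w ^ g == w)%g) sgc g w.
Definition inv_char A := cfRepr (inv_repr A).

Lemma inv_charE A g : perm_on A g -> inv_char A g = invc A g.
Proof.
move=> Ag; rewrite /invc big_mkcondr /= [RHS]big_enum_val /= cfunE inE Ag mulr1n /mxtrace.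
by apply: eq_bigr => i _; rewrite mxE eq_sym.
Qed.

Lemma inv_comm_sym A (X : 'M_#|invs A|) :
  (forall g, perm_on A g -> inv_mx A g *m X = X *m inv_mx A g) -> X^T = X.
Proof.
move=> comX; have w0I : 1%g \in invs A.
  by apply/invsP; rewrite perm_on1 mulg1.
pose r := enum_rank_in w0I.
pose a w u := X (r w) (r u).
suff a_sym w u : w \in invs A -> u \in invs A -> a w u = a u w.
  apply/matrixP => i j; rewrite mxE.
  have := a_sym _ _ (enum_valP j) (enum_valP i).
  by rewrite /a /r !enum_valK_in.
move=> /invsP[Aw ww] /invsP[Au uu].
apply: (@equivariant_sym n _ A a) => // {w u Aw ww Au uu} g w u Ag Aw Au ww uu.
have wI : w \in invs A by apply/invsP.
have uI : u \in invs A by apply/invsP.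
have rK v : v \in invs A -> enum_val (r v) = v.
  by move=> vI; rewrite /r enum_rankK_in.
have rJ v : v \in invs A -> enum_val (r (v ^ g)%g) = (enum_val (r v) ^ g)%g.
  by move=> vI; rewrite !rK ?invsJ.
have /matrixP/(_ (r w) (r (u ^ g)%g)) := comX g Ag.
rewrite (inv_mxl _ _ (rJ w wI)) mxE (bigD1 (r u)) //= big1 => [|k ne].
  by rewrite addr0 mxE rJ // eqxx !rK.
rewrite mxE rJ // (inj_eq (@conjg_inj _ g)) (inj_eq enum_val_inj) eq_sym.
by rewrite (negbTE ne) mulr0.
Qed.

End Reps.

Section MultFree.
Local Open Scope ring_scope.
Variables (n : nat).
Implicit Types (A B : {set 'I_n}) (g h w v : 'S_n).

Notation G_ A := (Sym_group A).

Lemma inv_char_mult_le1 A (i : Iirr (G_ A)) : '[inv_char A, 'chi_i] <= 1.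
Proof.
have Nchi : inv_char A \is a character by exact: cfRepr_char.
have /natrP[m mE] := Cnat_cfdot_char_irr i Nchi.
rewrite mE (ler_nat _ m 1) leqNgt; apply/negP => m_gt1.
have /(constt_charP _ Nchi)[chi1 Nchi1 e1] : i \in irr_constt (inv_char A).
  by rewrite inE /= mE pnatr_eq0; lia.
have /(constt_charP _ Nchi1)[chi2 /char_reprP[rH ->] e2] : i \in irr_constt chi1.
  rewrite inE /= (_ : chi1 = inv_char A - 'chi_i); last by rewrite e1 addrC addKr.
  by rewrite cfdotBl mE cfnorm_irr subr_eq0 (eqr_nat _ m 1); lia.
pose rI := Representation 'Chi_i.
pose rG2 := dadd_grepr rI (dadd_grepr rI rH).
have : cfRepr (inv_repr A) = cfRepr rG2.
  by rewrite /rG2 !cfRepr_dadd /= irrRepr -[LHS]/(inv_char A) e1 e2.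
case/cfRepr_inj => B eq_d fB hom.
have [P BP PB] : exists2 P, B *m P = 1%:M & P *m B = 1%:M.
  exists (pinvmx B); first exact: mulmxVp.
  by apply: mulVpmx; rewrite /row_full (eqP fB) eq_d.
have lift_comm E : (forall g, g \in G_ A -> rG2 g *m E = E *m rG2 g) ->
    (B *m E *m P)^T = B *m E *m P.
  move=> cE; apply: inv_comm_sym => g Ag.
  have gA : g \in G_ A by rewrite inE.
  have /= hg := hom g gA.
  have hgP : rG2 g *m P = P *m inv_mx A g.
    by rewrite -[LHS]mul1mx -PB -mulmxA (mulmxA B) -hg -(mulmxA _ B) BP mulmx1.
  by rewrite -[RHS]mulmxA -hgP !mulmxA hg -(mulmxA B (rG2 g)) cE // !mulmxA.
(* Two copies of ['chi_i] put the matrix units [e12] ([E1]) and [e11] ([E2]) in the commutant. They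
   do not commute, whereas symmetric matrices with a symmetric product do. *)
pose E1 : 'M[algC]_(rdegree rI + (rdegree rI + rdegree rH)) :=
  block_mx 0 (row_mx (1%:M : 'M_(rdegree rI)) 0) 0
    (0 : 'M_(rdegree rI + rdegree rH)).
pose E2 : 'M[algC]_(rdegree rI + (rdegree rI + rdegree rH)) :=
  block_mx (1%:M : 'M_(rdegree rI)) 0 0 (0 : 'M_(rdegree rI + rdegree rH)).
have cE1 g : g \in G_ A -> rG2 g *m E1 = E1 *m rG2 g.
  move=> _; rewrite /= /add_mx_repr /= !mulmx_block !(mulmx0, mul0mx, addr0, add0r).
  by rewrite mul_row_block mul_mx_row !(mulmx0, mul0mx, mulmx1, mul1mx, addr0).
have cE2 g : g \in G_ A -> rG2 g *m E2 = E2 *m rG2 g.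
  move=> _; rewrite /= /add_mx_repr /= !mulmx_block !(mulmx0, mul0mx, addr0, add0r).
  by rewrite mulmx1 mul1mx.
have E21 : E2 *m E1 = E1.
  by rewrite mulmx_block !(mulmx0, mul0mx, addr0, add0r) mul1mx.
have E12 : E1 *m E2 = 0.
  rewrite mulmx_block !(mulmx0, mul0mx, addr0, add0r).
  by rewrite -[RHS](block_mx0).
have symm1 := lift_comm _ cE1; have symm2 := lift_comm _ cE2.
have mulBEP (E F : 'M_(rdegree rG2)) :
    (B *m E *m P) *m (B *m F *m P) = B *m (E *m F) *m P.
  by rewrite !mulmxA -(mulmxA _ P) PB mulmx1.
have : (B *m E1 *m P) *m (B *m E2 *m P) = (B *m E2 *m P) *m (B *m E1 *m P).
  by rewrite -{1}symm1 -{1}symm2 -trmx_mul !mulBEP E21 symm1.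
rewrite !mulBEP E12 E21 mulmx0 mul0mx => /esym.
move/(congr1 (fun M => P *m M *m B)); rewrite mulmx0 mul0mx.
rewrite !mulmxA PB mul1mx -mulmxA PB mulmx1 => /eqP.
rewrite block_mx_eq0 row_mx_eq0 => /and4P[_ /andP[/eqP/matrixP e0 _] _ _].
have d_gt0 : (0 < rdegree rI)%N by rewrite /= irr_degree_gt0.
by have /eqP := e0 (Ordinal d_gt0) (Ordinal d_gt0); rewrite !mxE eqxx oner_eq0.
Qed.

End MultFree.

(** * Branching for the symmetric groups *)

Section Branching.
Local Open Scope ring_scope.
Variables (n : nat).
Implicit Types (A B : {set 'I_n}) (g h w v : 'S_n) (x y : 'I_n).

Notation G_ A := (Sym_group A).

Lemma in_SymD1 A x g : (g \in G_ (A :\ x)) = (g \in G_ A) && (g x == x).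
Proof.
rewrite !inE; apply/idP/andP => [Sg|[Sg /eqP fx]].
  split; first exact: subset_trans Sg (subD1set _ _).
  by rewrite (out_perm Sg) // !inE eqxx.
apply/subsetP => y ny; rewrite !inE (subsetP Sg _ ny) andbT.
have ngy : g y != y by [].
by apply: contraNneq ngy => ->; apply/eqP.
Qed.

Lemma perm_onD1 A x g : perm_on (A :\ x) g = perm_on A g && (g x == x).
Proof. by have := in_SymD1 A x g; rewrite !inE. Qed.

Lemma SymS A B : A \subset B -> G_ A \subset G_ B.
Proof.
by move=> AB; apply/subsetP => g; rewrite !inE => /subset_trans; apply.
Qed.

Lemma tperm_Sym A x y : x \in A -> y \in A -> tperm x y \in G_ A.
Proof.
move=> xA yA; rewrite inE; apply: subset_trans (tperm_on x y) _.
by apply/subsetP => z; rewrite !inE => /orP[] /eqP->.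
Qed.

(** The transpositions [tperm a x], the identity for [x = a], represent the cosets of the stabilizer
    of [a]. *)
Lemma cfInd_SymE A a (phi : 'CF(G_ (A :\ a))) g : a \in A -> g \in G_ A ->
  'Ind[G_ A] phi g = \sum_(x in A) phi (g ^ tperm a x)%g.
Proof.
move=> aA gA; rewrite cfIndE ?SymS ?subD1set //.
rewrite (partition_big (fun y : 'S_n => (y^-1)%g a) (mem A)) /=; last first.
  by move=> y; rewrite -groupV inE => yA; rewrite perm_closed.
rewrite mulr_sumr; apply: eq_bigr => x xA.
have tA := tperm_Sym aA xA.
rewrite (reindex_inj (mulgI (tperm a x))) /=.
rewrite (eq_bigl (mem (G_ (A :\ a)))) => [|h] /=; last first.
  rewrite groupMl // -/(h \in G_ A) invMg permM tpermV in_SymD1; congr andb.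
  rewrite -(inj_eq (@perm_inj _ (tperm a x))) tpermK tpermR.
  by rewrite -(inj_eq (@perm_inj _ h)) permKV eq_sym.
rewrite (eq_bigr (fun=> phi (g ^ tperm a x)%g)) => [|h hA]; last first.
  by rewrite conjgM cfunJ.
rewrite sumr_const -[X in _ * X]mulr_natl mulKf //.
by rewrite pnatr_eq0 -lt0n cardG_gt0.
Qed.

Lemma perm_ne_fix A a g : g \in G_ (A :\ a) -> g a = a.
Proof. by rewrite in_SymD1 => /andP[_ /eqP]. Qed.

Lemma tpermJ_fix g x y : g x = x -> g y = y -> (g ^ tperm x y)%g = g.
Proof.
move=> gx gy; have e : (g * tperm x y = tperm x y * g)%g.
  by rewrite [RHS]conjgC tpermJ gx gy.
by rewrite conjgE e mulKg.
Qed.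

Lemma cfRes_Ind_Sym A a (phi : 'CF(G_ (A :\ a))) g :
    a \in A -> g \in G_ (A :\ a) ->
  'Ind[G_ A] phi g = (1 + #|[set x in A :\ a | g x == x]|%:R) * phi g.
Proof.
move=> aA gB; have gA : g \in G_ A by move: gB; rewrite in_SymD1 => /andP[].
have ga := perm_ne_fix gB.
rewrite cfInd_SymE // (bigD1 a) //= tperm1 conjg1 mulrDl mul1r; congr (_ + _).
rewrite -sum1dep_card natr_sum mulr_suml [RHS]big_mkcondr /=.
rewrite (eq_bigl (mem (A :\ a))) => [|x]; last by rewrite !inE andbC.
apply: eq_bigr => x _; case: eqP => [gx|/eqP gx].
  by rewrite mul1r tpermJ_fix.
rewrite cfun0 // in_SymD1 negb_and; apply/orP; right.
apply: contra gx => /eqP e; apply/eqP.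
by apply: (@perm_inj _ (tperm a x)); rewrite -conjpE tpermR e.
Qed.

Lemma conj_tpermE g a x :
  ((g ^ tperm a x)%g a == a) = (tperm a x (g x) == tperm a x x).
Proof. by have := conjpE g (tperm a x) x; rewrite tpermR => ->. Qed.

Lemma cfInd_Res_Sym A a (phi : 'CF(G_ A)) g : a \in A -> g \in G_ A ->
  'Ind[G_ A] ('Res[G_ (A :\ a)] phi) g = #|[set x in A | g x == x]|%:R * phi g.
Proof.
move=> aA gA; rewrite cfInd_SymE // -sum1dep_card natr_sum mulr_suml.
rewrite [RHS]big_mkcondr /=; apply: eq_bigr => x xA.
have tA := tperm_Sym aA xA.
have gJ : ((g ^ tperm a x)%g \in G_ (A :\ a)) = (g x == x).
  rewrite in_SymD1 groupJr // gA /=.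
  by rewrite conj_tpermE (inj_eq perm_inj).
case: ifP => gx; last by rewrite cfun0 // gJ gx.
by rewrite cfResE ?SymS ?subD1set // ?gJ // cfunJ // mul1r.
Qed.

Lemma invs_conj A a x (v : 'S_n) : a \in A -> x \in A ->
  ((v ^ tperm a x)%g \in invs (A :\ a)) = (v \in invs (A :\ x)).
Proof.
move=> aA xA; have tA := tperm_Sym aA xA.
have gJ : ((v ^ tperm a x)%g \in G_ (A :\ a)) = (v \in G_ (A :\ x)).
  rewrite !in_SymD1 groupJr //; congr andb.
  by rewrite conj_tpermE (inj_eq perm_inj).
rewrite !inE in gJ *; rewrite gJ; congr andb.
by rewrite -conjMg -{1}(conj1g (tperm a x)) (inj_eq (@conjg_inj _ _)).
Qed.

Lemma invc_conj A a x g : a \in A -> x \in A ->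
  invc (A :\ a) (g ^ tperm a x)%g = invc (A :\ x) g.
Proof.
move=> aA xA; rewrite /invc (reindex_inj (@conjg_inj _ (tperm a x))) /=.
apply: eq_big => [v|v /andP[]].
  rewrite invs_conj //; congr andb.
  by rewrite -conjJg (inj_eq (@conjg_inj _ _)).
rewrite invs_conj // => /invsP[_ vv] /eqP vg.
rewrite /sgc sg_conj //.
by move: vg; rewrite -conjJg => /conjg_inj.
Qed.

(** Sort the involutions by [x = w a]. For [x != a], commuting with [g] forces [g x = x], and
    deleting the 2-cycle of [a] and [x] leaves an involution on [A :\ a :\ x]. The sign is
    unchanged, as [g] fixes both deleted points. *)
Lemma invc_branch A a g : a \in A -> g \in G_ (A :\ a) ->
  invc A g = invc (A :\ a) g +
    \sum_(x in A :\ a | g x == x) invc (A :\ a :\ x) g.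
Proof.
move=> aA gB; have ga := perm_ne_fix gB.
rewrite /invc (partition_big (fun w : 'S_n => w a) (mem A)) /=; last first.
  by move=> w /andP[/invsP[Aw _] _]; rewrite perm_closed.
rewrite (bigD1 a) //=; congr (_ + _).
  apply: eq_bigl => w; rewrite andbAC; congr andb.
  rewrite !inE perm_onD1.
  by rewrite -!andbA; congr andb; rewrite andbC.
rewrite [RHS]big_mkcondr /=.
rewrite (eq_bigl (mem (A :\ a))) => [|x]; last by rewrite !inE andbC.
apply: eq_bigr => x; rewrite /= !inE => /andP[xa xA].
case: eqP => gx; last first.
  apply: big1 => w /andP[/andP[_ /eqP wg] /eqP wa]; case: gx.
  by rewrite -wa -conjpE wg ga.
have tA := tperm_Sym aA xA.
rewrite (reindex_inj (mulIg (tperm a x))) /=.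
have vfix (v : 'S_n) : v a = a -> v x = x -> (v * tperm a x = tperm a x * v)%g.
  by move=> va vx; rewrite conjgC; congr (_ * _)%g; apply: tpermJ_fix.
have tt : (tperm a x * tperm a x = 1)%g by rewrite tperm2.
have cond v : [&& (v * tperm a x)%g \in invs A,
      ((v * tperm a x) ^ g == v * tperm a x)%g & (v * tperm a x)%g a == x]
    = (v \in invs (A :\ a :\ x)) && (v ^ g == v)%g.
  have -> : ((v * tperm a x) ^ g == v * tperm a x)%g = (v ^ g == v)%g.
    by rewrite conjMg tpermJ ga gx (inj_eq (mulIg _)).
  rewrite !inE !perm_onD1.
  have -> : perm_on A (v * tperm a x)%g = perm_on A v.
    by have := groupMr v tA; rewrite !inE.
  have -> : ((v * tperm a x)%g a == x) = (v a == a).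
    by rewrite permM -[X in _ == X](tpermL a x) (inj_eq perm_inj).
  case: (perm_on A v) => //=; case: (v ^ g == v)%g; rewrite ?andbF //= !andbT.
  case: (eqVneq (v a) a) => [va|_]; last by rewrite andbF.
  rewrite andbT /=; apply/eqP/andP => [vv|[/eqP vx /eqP vv]]; last first.
    by rewrite {2}vfix // mulgA -(mulgA v) tt mulg1.
  have vx : v x = x.
    have := congr1 (fun s : 'S_n => s a) vv.
    rewrite !permM va tpermL perm1 => e.
    by apply: (@perm_inj _ (tperm a x)); rewrite e tpermR.
  split; apply/eqP => //.
  by move: vv; rewrite {2}vfix // mulgA -(mulgA v) tt mulg1.
apply: eq_big => [v|v]; first by rewrite -cond andbA.
rewrite -andbA cond => /andP[vI _].
have vB : v \in G_ (A :\ a :\ x) by move: vI; rewrite inE => /andP[].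
have vx := perm_ne_fix vB.
have va : v a = a by move: vB; rewrite in_SymD1 => /andP[/perm_ne_fix].
rewrite /sgc /sg; congr (_ ^+ nat_of_bool _).
rewrite big_mkcond [RHS]big_mkcond /=; apply: eq_bigr => y _.
rewrite permM; case: tpermP => [e|e|/eqP ya /eqP yx //].
- have -> : y = a by apply: (@perm_inj _ v); rewrite va.
  by rewrite va ltnn gx ga; case: ltngtP.
- have -> : y = x by apply: (@perm_inj _ v); rewrite vx.
  by rewrite vx ltnn gx ga; case: ltngtP.
Qed.

End Branching.

(** * Every irreducible character occurs exactly once in the model at [q = 1] *)

Section Faithful.
Local Open Scope ring_scope.
Variables (n : nat).
Implicit Types (A B : {set 'I_n}) (g h w v : 'S_n) (x y : 'I_n).

Notation G_ A := (Sym_group A).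

Lemma cfRes_inv_char A a b : a \in A -> b \in A :\ a ->
  'Res[G_ (A :\ a)] (inv_char A) =
    inv_char (A :\ a) + 'Ind[G_ (A :\ a)] (inv_char (A :\ a :\ b)).
Proof.
move=> aA bB; apply/cfun_inP => g gB.
have gA : g \in G_ A by move: gB; rewrite in_SymD1 => /andP[].
rewrite cfResE ?SymS ?subD1set // [RHS]cfunE.
have [Ag Bg] : perm_on A g /\ perm_on (A :\ a) g.
  by move: gA gB; rewrite !inE.
rewrite (inv_charE Ag) (inv_charE Bg) (invc_branch aA gB) cfInd_SymE //; congr (_ + _).
rewrite big_mkcondr /=; apply: eq_bigr => x xB.
have tB := tperm_Sym bB xB.
have gJ : ((g ^ tperm b x)%g \in G_ (A :\ a :\ b)) = (g x == x).
  by rewrite in_SymD1 groupJr // gB /= conj_tpermE (inj_eq perm_inj).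
case: ifP => gx; last by rewrite cfun0 // gJ gx.
by rewrite inv_charE ?invc_conj //; move: gJ; rewrite gx inE.
Qed.

Lemma cfRes_inv_char0 A a : a \in A -> A :\ a = set0 ->
  'Res[G_ (A :\ a)] (inv_char A) = inv_char (A :\ a).
Proof.
move=> aA B0; apply/cfun_inP => g gB.
have gA : g \in G_ A by move: gB; rewrite in_SymD1 => /andP[].
rewrite cfResE ?SymS ?subD1set //.
have [Ag Bg] : perm_on A g /\ perm_on (A :\ a) g.
  by move: gA gB; rewrite !inE.
rewrite (inv_charE Ag) (inv_charE Bg).
by rewrite (invc_branch aA gB) big1 ?addr0 // => x; rewrite {1}B0 inE.
Qed.

(** Mackey's formula [Res Ind phi = phi + Ind Res phi], read off from the fixed point counts in
    [cfRes_Ind_Sym] and [cfInd_Res_Sym], combined with Frobenius reciprocity. *)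
Lemma cfnorm_Ind_Sym A a b (phi : 'CF(G_ (A :\ a))) : a \in A -> b \in A :\ a ->
  '['Ind[G_ A] phi] = '[phi] + '['Res[G_ (A :\ a :\ b)] phi].
Proof.
move=> aA bB; rewrite -Frobenius_reciprocity [X in _ + X]cfdot_Res_l -cfdotDr.
congr '[_, _]; apply/cfun_inP => g gB.
have gA : g \in G_ A by move: gB; rewrite in_SymD1 => /andP[].
rewrite cfResE ?SymS ?subD1set // cfRes_Ind_Sym // [RHS]cfunE cfInd_Res_Sym //.
by rewrite mulrDl mul1r.
Qed.

Lemma cfnorm_Ind_Sym0 A a (phi : 'CF(G_ (A :\ a))) : a \in A -> A :\ a = set0 ->
  '['Ind[G_ A] phi] = '[phi].
Proof.
move=> aA B0; rewrite -Frobenius_reciprocity.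
congr '[_, _]; apply/cfun_inP => g gB.
have gA : g \in G_ A by move: gB; rewrite in_SymD1 => /andP[].
rewrite cfResE ?SymS ?subD1set // cfRes_Ind_Sym //.
rewrite (_ : [set x in _ | _] = set0) ?cards0 ?addr0 ?mul1r //.
by apply/setP => x; rewrite !inE; have := in_set0 x; rewrite -B0 !inE => ->.
Qed.

Definition gelfand_char A := forall i : Iirr (G_ A), '[inv_char A, 'chi_i] = 1.
Definition simple_branching A a := forall (i : Iirr (G_ A)) j,
  '['Ind[G_ A] 'chi[G_ (A :\ a)]_j, 'chi_i] ^+ 2 =
  '['Ind[G_ A] 'chi[G_ (A :\ a)]_j, 'chi_i].

(* The multiplicities [c] of an induced irreducible satisfy [c <= c ^ 2] while
   those, [m], of the model are at most 1; equality of [\sum c ^ 2] and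
   [\sum c * m] forces [c = 0] or [c = m = 1]. *)
Lemma gelfand_step A a : a \in A ->
  (forall j : Iirr (G_ (A :\ a)),
     '['Ind[G_ A] 'chi_j] = '['Ind[G_ A] 'chi_j, inv_char A]) ->
  gelfand_char A /\ simple_branching A a.
Proof.
move=> aA eq_norm.
pose m (i : Iirr (G_ A)) := '[inv_char A, 'chi_i].
have mN i : m i \is a Num.nat by apply: Cnat_cfdot_char_irr; apply: cfRepr_char.
have aN (j : Iirr (G_ (A :\ a))) (i : Iirr (G_ A)) :
    '['Ind[G_ A] 'chi_j, 'chi_i] \is a Num.nat.
  by apply: Cnat_cfdot_char_irr; apply/cfInd_char/irr_char.
have key (j : Iirr (G_ (A :\ a))) (i : Iirr (G_ A)) :
    let aji := '['Ind[G_ A] 'chi_j, 'chi_i] in aji = 0 \/ aji = 1 /\ m i = 1.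
  pose c i := '['Ind[G_ A] 'chi_j, 'chi_i].
  have ge0 k : true -> 0 <= c k * (c k - m k).
    move=> _; have /natrP[p pE] := aN j k; rewrite /c pE.
    case: p {pE} => [|p]; first by rewrite mul0r.
    rewrite mulr_ge0 ?ler0n // subr_ge0.
    by apply: le_trans (inv_char_mult_le1 k) _; rewrite (ler_nat _ 1).
  have sum0 : \sum_k c k * (c k - m k) = 0.
    have := eq_norm j; rewrite !(cfdot_sum_irr ('Ind[G_ A] 'chi_j)).
    move/eqP; rewrite -subr_eq0 -sumrB => /eqP e; rewrite -[RHS]e.
    apply: eq_bigr => k _.
    by rewrite (conj_natr (aN j k)) (conj_natr (mN k)) mulrBr.
  have /(_ i isT)/eqP := psumr_eq0P ge0 sum0.
  rewrite mulf_eq0 subr_eq0 => /orP[/eqP|/eqP cm]; first by left.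
  have := inv_char_mult_le1 i; rewrite -/(m i).
  have /natrP[p pE] := mN i; rewrite /= -/(c i) cm pE (ler_nat _ p 1).
  by case: p {pE} => [|[|p]] //; [left | right].
split=> [i|i j]; last first.
  by case: (key j i) => [->|[-> _]]; rewrite ?expr0n ?expr1n.
(* Any constituent ['chi_j] of the restriction has ['chi_i] in its induction, which excludes
   [c = 0]. *)
have /neq0_has_constt[j] : 'Res[G_ (A :\ a)] 'chi_i != 0.
  by rewrite cfRes_eq0 ?irr_char ?irr_neq0.
rewrite inE /= cfdot_Res_l.
have -> : '['chi_i, 'Ind[G_ A] 'chi_j] = '['Ind[G_ A] 'chi_j, 'chi_i].
  by rewrite cfdotC conj_natr.
by case: (key j i) => [->|[_ //]]; rewrite eqxx.
Qed.

Lemma gelfand_char_set0 : gelfand_char set0.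
Proof.
move=> i.
have S1 g : g \in G_ set0 -> g = 1%g.
  by rewrite inE => Sg; apply/permP => x; rewrite (out_perm Sg) ?inE ?perm1.
have G1 : Sym set0 = [set 1%g :> 'S_n].
  apply/setP => g; apply/idP/set1P => [|->]; [exact: S1 | exact: group1].
have i0 : i = 0.
  have N1 : Nirr (G_ (set0 : {set 'I_n})) = 1%N.
    by rewrite NirrE /classes /= G1 imset_set1 cards1.
  have lt : (i < 1)%N by rewrite -[X in (_ < X)%N]N1.
  by apply: val_inj => /=; case: (val i) lt.
rewrite i0 irr0 cfdotE.
rewrite (eq_bigl (pred1 (1%g : 'S_n))) => [|g]; last first.
  by apply/idP/eqP => [/S1|->] //; apply: group1.
rewrite big_pred1_eq cfun1E group1 conjC1 mulr1 inv_charE ?perm_on1 //.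
rewrite /invc (big_pred1 1%g) => [|w]; last first.
  apply/andP/eqP => [[/invsP[Sw _] _]|->]; first by apply: S1; rewrite inE.
  by rewrite conj1g eqxx; split=> //; apply/invsP; rewrite perm_on1 mulg1.
by rewrite /sgc sg1 /= G1 cards1 invr1 mul1r.
Qed.

(** Both sides required by [gelfand_step] are computed lower down. The norm of the induced ['chi_j]
    is 1 plus the norm of its restriction, a sum of [c ^ 2]. Its product with the model is 1 plus
    the product of that restriction with the model of [A :\ a :\ b], a sum of [c] because that model
    contains each irreducible once. Simple branching for [A :\ a] equates the two sums. *)
Lemma gelfand_all A : gelfand_char A /\ (forall a, a \in A -> simple_branching A a).
Proof.
have [m] := ubnP #|A|; elim: m A => // m IH A leA.
suff step a : a \in A -> gelfand_char A /\ simple_branching A a.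
  split=> [|a aA]; last by have [] := step a aA.
  have [->|/set0Pn[a aA]] := eqVneq A set0; first exact: gelfand_char_set0.
  by have [] := step a aA.
move=> aA; have ltB : (#|A :\ a| < #|A|)%N by rewrite [in X in (_ < X)%N](cardsD1 a) aA.
have [gB sB] := IH (A :\ a) (leq_trans ltB leA).
apply: gelfand_step => // j.
have [B0|/set0Pn[b bB]] := eqVneq (A :\ a) set0.
  rewrite cfnorm_Ind_Sym0 // cfnorm_irr -Frobenius_reciprocity cfRes_inv_char0 //.
  by rewrite cfdotC gB conjC1.
have ltC : (#|A :\ a :\ b| < #|A :\ a|)%N.
  by rewrite [in X in (_ < X)%N](cardsD1 b) bB.
have [gC _] := IH (A :\ a :\ b) (leq_trans (ltn_trans ltC ltB) leA).
rewrite (cfnorm_Ind_Sym _ aA bB) cfnorm_irr -Frobenius_reciprocity.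
rewrite (cfRes_inv_char aA bB) cfdotDr [X in _ = X + _]cfdotC gB conjC1; congr (_ + _).
rewrite -cfdot_Res_l !cfdot_sum_irr; apply: eq_bigr => k _.
have E : '['Res[G_ (A :\ a :\ b)] 'chi_j, 'chi_k] =
         '['Ind[G_ (A :\ a)] 'chi_k, 'chi_j].
  rewrite cfdot_Res_l cfdotC conj_natr //.
  by apply: Cnat_cfdot_char_irr; apply/cfInd_char/irr_char.
rewrite gC conjC1 mulr1 E conj_natr; first exact: sB.
by apply: Cnat_cfdot_char_irr; apply/cfInd_char/irr_char.
Qed.

End Faithful.

(** * Faithfulness of the group algebra at [q = 1] *)

Section Faithful.
Local Open Scope ring_scope.
Variables (n : nat).
Implicit Types (g h w v : 'S_n) (x y : 'I_n).

Notation G := (Sym_group [set: 'I_n]).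

Lemma in_SymT g : g \in G.
Proof. by rewrite inE; apply/subsetP. Qed.

(** The hypothesis says that [\sum_g c g g] acts by zero on the signed involutions. The trace of its
    product with any [z] involves the sum of all irreducible characters; convolution with ['chi_i]
    isolates one of them, and the regular character then recovers each [c g]. *)
Lemma signed_inv_free (c : 'S_n -> algC) :
  (forall w u : 'S_n, (w * w = 1)%g -> (u * u = 1)%g ->
     \sum_(g | (w ^ g == u)%g) c g * (-1) ^+ sg g w = 0) ->
  forall g, c g = 0.
Proof.
move=> c0.
have invsT w : (w \in invs [set: 'I_n]) = ((w * w)%g == 1%g).
  by rewrite inE in_SymT.
have trace0 z : \sum_g c g * inv_char [set: 'I_n] (g * z)%g = 0.
  have inv_charTE (y : 'S_n) : inv_char [set: 'I_n] y = invc [set: 'I_n] y.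
    by apply: inv_charE; apply/subsetP.
  under eq_bigr => g _ do rewrite inv_charTE /invc mulr_sumr big_mkcondr /=.
  rewrite exchange_big big1 //= => w; rewrite invsT => /eqP ww.
  rewrite (partition_big (fun g => w ^ g)%g predT) //= big1 // => u _.
  have [uz|uz] := eqVneq (u ^ z)%g w; last first.
    by apply: big1 => g /eqP wg; rewrite conjgM wg (negbTE uz).
  have [uu|nuu] := eqVneq (u * u)%g 1%g; last first.
    apply: big1 => g /eqP wg; case/eqP: nuu.
    by rewrite -wg conjg_inv.
  have := congr1 (fun t => t * (-1) ^+ sg z u) (c0 w u ww uu).
  rewrite mul0r mulr_suml => e; rewrite -[RHS]e; apply: eq_bigr => g /eqP wg.
  by rewrite conjgM wg uz eqxx /sgc sgM // wg signr_addb mulrA.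
have inv_sum : inv_char [set: 'I_n] = \sum_i 'chi[G]_i.
  rewrite [LHS]cfun_sum_cfdot; apply: eq_bigr => i _.
  by rewrite (proj1 (gelfand_all _)) scale1r.
have irr0 (i : Iirr G) (y : 'S_n) : \sum_g c g * 'chi_i (y * g)%g = 0.
  have : \sum_(z in G) (\sum_g c g * inv_char [set: 'I_n] (g * (z * y))%g)
           * 'chi_i z^-1%g = 0.
    by apply: big1 => z _; rewrite trace0 mul0r.
  under eq_bigr => z _ do rewrite mulr_suml.
  rewrite exchange_big /= => e.
  have nz : (#|G|%:R / 'chi_i 1%g : algC) != 0.
    by rewrite mulf_neq0 ?invr_eq0 ?irr1_neq0 // pnatr_eq0 -lt0n cardG_gt0.
  apply: (mulIf nz); rewrite mul0r -[RHS]e mulr_suml; apply: eq_bigr => g _.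
  have -> : \sum_(z in G) c g * inv_char [set: 'I_n] (g * (z * y))%g * 'chi_i z^-1%g
      = c g * \sum_j \sum_(z in G) 'chi[G]_j (z * (y * g))%g * 'chi_i z^-1%g.
    rewrite exchange_big mulr_sumr /=; apply: eq_bigr => z zG.
    rewrite -mulrA; congr (_ * _); rewrite -mulr_suml; congr (_ * _).
    rewrite inv_sum sum_cfunE; apply: eq_bigr => j _.
    have -> : (z * (y * g) = (g * (z * y)) ^ g)%g by rewrite conjgE -!mulgA mulKg.
    by rewrite cfunJ ?in_SymT.
  rewrite (bigD1 i) //= [X in _ + X]big1 => [|j ne]; last first.
    have := generalized_orthogonality_relation (y * g) j i.
    rewrite (negbTE ne) mul0r => /eqP; rewrite mulf_eq0 invr_eq0 pnatr_eq0.
    by rewrite eqn0Ngt cardG_gt0 => /eqP.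
  have := generalized_orthogonality_relation (y * g) i i.
  rewrite eqxx mul1r => /(canRL (mulVKf _)) ->; last first.
    by rewrite pnatr_eq0 -lt0n cardG_gt0.
  by rewrite addr0; ring.
move=> g.
have : \sum_(i : Iirr G) 'chi_i 1%g * \sum_h c h * 'chi_i (g^-1 * h)%g = 0.
  by apply: big1 => i _; rewrite irr0 mulr0.
under eq_bigr => i _ do rewrite mulr_sumr.
rewrite exchange_big /= (bigD1 g) //= [X in _ + X]big1 => [|h ne]; last first.
  under eq_bigr => i _ do rewrite mulrCA.
  rewrite -mulr_sumr.
  have := congr1 (fun f : 'CF(G) => f (g^-1 * h)%g) (cfReg_sum G).
  rewrite cfRegE sum_cfunE => /esym.
  under eq_bigr => i _ do rewrite cfunE.
  move=> ->; case: eqP => [e|_]; last by rewrite mulr0.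
  by case/eqP: ne; apply: (mulgI g^-1%g); rewrite e mulVg.
under eq_bigr => i _ do rewrite mulrCA.
rewrite -mulr_sumr addr0.
have := congr1 (fun f : 'CF(G) => f (g^-1 * g)%g) (cfReg_sum G).
rewrite cfRegE sum_cfunE => /esym.
under eq_bigr => i _ do rewrite cfunE.
move=> ->; rewrite mulVg eqxx => /eqP; rewrite mulf_eq0 => /orP[/eqP //|].
by rewrite mulr1n pnatr_eq0 eqn0Ngt cardG_gt0.
Qed.

End Faithful.

(** * Coxeter length and involutive length *)

Section Length.
Local Open Scope group_scope.
Variables (n : nat).
Implicit Types (g w v u : 'S_n) (x y a b : 'I_n) (i : 'I_n.-1).

Lemma lo_subproof i : i < n. Proof. by have := ltn_ord i; lia. Qed.
Lemma hi_subproof i : i.+1 < n. Proof. by have := ltn_ord i; lia. Qed.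
Definition lo i : 'I_n := Ordinal (lo_subproof i).
Definition hi i : 'I_n := Ordinal (hi_subproof i).

Lemma sgenE i : sgen i = tperm (lo i) (hi i).
Proof.
by rewrite /sgen /tpermn (insubT (fun k => k < n) (lo_subproof i))
  (insubT (fun k => k < n) (hi_subproof i)).
Qed.

Lemma desE i w : des i w = (w (hi i) < w (lo i)).
Proof.
by rewrite /des (insubT (fun k => k < n) (lo_subproof i))
  (insubT (fun k => k < n) (hi_subproof i)).
Qed.

Lemma lo_hi i : lo i != hi i.
Proof. by rewrite -val_eqE /=; lia. Qed.

Lemma ell_le v : ell v <= n * n.
Proof.
by apply: leq_trans (max_card _) _; rewrite card_prod card_ord.
Qed.

(** The product swaps the values at the positions [p < q]. Keeping an inversion that lies within
    [[p, q]] and renaming the positions of any other by [t'] injects the inversions of [v] into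
    those of the product, and misses [(p, q)]. *)
Lemma ell_tperm v a b : a < b -> v^-1 a < v^-1 b -> ell v < ell (v * tperm a b).
Proof.
move=> ab; set p := v^-1 a; set q := v^-1 b => pq.
have vp : v p = a by rewrite permKV.
have vq : v q = b by rewrite permKV.
set t := tperm a b; set t' := tperm p q.
pose f (z : 'I_n * 'I_n) :=
  if (p <= z.1) && (z.2 <= q) then z else (t' z.1, t' z.2).
have t'p : t' p = q by rewrite tpermL.
have t'q : t' q = p by rewrite tpermR.
have t'N x : x != p -> x != q -> t' x = x.
  by move=> xp xq; rewrite /t' tpermD // eq_sym.
have vt x : (v * t) (t' x) = v x.
  rewrite permM /t /t' -vp -vq; case: tpermP => [->|->|/eqP xp /eqP xq].
  - by rewrite tpermR.
  - by rewrite tpermL.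
  by rewrite tpermD // (inj_eq perm_inj) eq_sym.
have vtN x : x != p -> x != q -> (v * t) x = v x.
  by move=> xp xq; rewrite -{1}(t'N x xp xq) vt.
have vtp : (v * t) p = b by rewrite permM vp tpermL.
have vtq : (v * t) q = a by rewrite permM vq tpermR.
rewrite /ell; set I1 := [set _ | _]; set I2 := [set _ | _].
have pqI2 : (p, q) \in I2 by rewrite inE /= pq vtp vtq.
rewrite (cardsD1 (p, q) I2) pqI2 add1n ltnS.
have t'out x y : x < y -> ~~ ((p <= x) && (y <= q)) ->
    t' x < t' y /\ ~~ ((p <= t' x) && (t' y <= q)).
  move=> xy out; rewrite /t'.
  case: tpermP => [ex|ex|/eqP x1 /eqP x2]; case: tpermP => [ey|ey|/eqP y1 /eqP y2];
    rewrite ?ex ?ey in out xy *; lia.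
have fI x y : x < y -> v y < v x -> f (x, y) \in I2 :\ (p, q).
  move=> xy vyx; rewrite 3!inE /f /=; case: ifP => [/andP[px yq]|/negbT out] /=.
    rewrite xpair_eqE xy /=.
    have -> : ~~ ((x == p) && (y == q)).
      by apply/negP => /andP[/eqP ex /eqP ey]; move: vyx; rewrite ex ey vp vq; lia.
    have [ex|xp] := eqVneq x p.
      have yp : y != p by rewrite -ex -val_eqE /=; lia.
      have yq' : y != q.
        by apply/eqP => ey; move: vyx; rewrite ex ey vp vq; lia.
      by rewrite ex vtp vtN //; move: vyx; rewrite ex vp; lia.
    have xq : x != q by rewrite -val_eqE /=; lia.
    rewrite (vtN x) //; have [ey|yq'] := eqVneq y q.
      by rewrite ey vtq; move: vyx; rewrite ey vq; lia.
    have yp : y != p by rewrite -val_eqE /=; lia.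
    by rewrite vtN.
  have [lt out'] := t'out x y xy out.
  rewrite !vt vyx lt xpair_eqE !andbT; apply: contra out' => /andP[/eqP-> /eqP->].
  by rewrite !leqnn.
have <- : #|f @: I1| = #|I1|.
  apply: card_in_imset => -[x y] [x' y']; rewrite !inE /= => /andP[xy _] /andP[xy' _].
  rewrite /f /=; case: ifP => [r1|/negbT r1]; case: ifP => [r2|/negbT r2] //.
  - by move=> [ex ey]; have [_] := t'out _ _ xy' r2; rewrite -ex -ey r1.
  - by move=> [ex ey]; have [_] := t'out _ _ xy r1; rewrite ex ey r2.
  by move=> [/perm_inj-> /perm_inj->].
apply/subset_leq_card/subsetP => z /imsetP[[x y]]; rewrite inE /= => /andP[xy vyx] ->.
exact: fI.
Qed.

Lemma ell_sgen v i : ell (v * sgen i) <= (ell v).+1.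
Proof.
rewrite sgenE; set a := lo i; set b := hi i.
have [lt|ge] := ltnP (v^-1 b) (v^-1 a).
  suff /ltnW/leqW : ell (v * tperm a b) < ell v by [].
  have := @ell_tperm (v * tperm a b) a b (ltnSn _).
  by rewrite -mulgA tperm2 mulg1 invMg !permM tpermV tpermL tpermR; apply.
set p := v^-1 a; set q := v^-1 b.
have vp : v p = a by rewrite permKV.
have vq : v q = b by rewrite permKV.
rewrite /ell -add1n; set I1 := [set _ | _]; set I2 := [set _ | _].
apply: leq_trans (_ : #|(p, q) |: I2| <= _); last by rewrite cardsU1; case: (_ \notin _).
apply/subset_leq_card/subsetP => -[x y]; rewrite !inE /= !permM => /andP[xy lt].
rewrite xy /=; apply/orP; move: lt.
have [[ex ey]|ne] : (v x = a /\ v y = b) \/ ~ (v x = a /\ v y = b).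
- by case: (eqVneq (v x) a) => [->|/eqP]; case: (eqVneq (v y) b) => [->|/eqP]; tauto.
- by left; rewrite xpair_eqE /p /q -ex -ey !permK !eqxx.
move=> lt; right; move: lt ne.
have ab : b = a.+1 :> nat by [].
have aE : a = i :> nat by [].
case: tpermP => [ex|ex|/eqP x1 /eqP x2]; case: tpermP => [ey|ey|/eqP y1 /eqP y2];
  rewrite ?ex ?ey ?ab ?ltnn //;
  try (rewrite -val_eqE /= in x1); try (rewrite -val_eqE /= in x2);
  try (rewrite -val_eqE /= in y1); try (rewrite -val_eqE /= in y2);
  move=> lt' ne; try lia.
by case: ne.
Qed.

End Length.

Section InvLength.
Local Open Scope group_scope.
Variables (n : nat).
Implicit Types (g w v u : 'S_n) (x y a b : 'I_n) (i : 'I_n.-1).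

Lemma invol_inv w : w * w = 1 -> w^-1 = w.
Proof. by move=> ww; rewrite -[LHS]mulg1 -ww mulKg. Qed.

Lemma tpermnE k l x : k < n -> l < n ->
  tpermn n k l x = (if x == k :> nat then l else if x == l :> nat then k else x) :> nat.
Proof.
move=> kn ln; rewrite /tpermn (insubT (fun k => k < n) kn) (insubT (fun k => k < n) ln).
case: tpermP => [->|->|/eqP x1 /eqP x2] /=; rewrite ?eqxx //.
  by case: eqP.
by rewrite -!val_eqE /= in x1 x2; rewrite (negbTE x1) (negbTE x2).
Qed.

Lemma wkS k : wk n k.+1 = wk n k * tpermn n k.*2 k.*2.+1.
Proof. by rewrite /wk big_ord_recr. Qed.

Lemma wkE k x : k.*2 <= n ->
  wk n k x = (if x < k.*2 then (if odd x then x.-1 else x.+1) else x) :> nat.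
Proof.
elim: k => [|k IH] kn; first by rewrite /wk big_ord0 perm1.
rewrite wkS permM tpermnE ?IH; try lia.
rewrite doubleS; case: (ltnP x k.*2) => xk; case: (boolP (odd x)) => ox;
  repeat case: ifP; move=> *; lia.
Qed.

(** [p'] and [q'] stand for the images under [wk n k], whose 2-cycles are consecutive pairs filling
    an initial segment. So fixed points come last and, in [wk_blocks], distinct pairs are ordered as
    blocks. *)
Lemma wk_fix_last (k p q p' q' : nat) :
  p' = (if p < k.*2 then (if odd p then p.-1 else p.+1) else p) ->
  q' = (if q < k.*2 then (if odd q then q.-1 else q.+1) else q) ->
  p' = p -> q' != q -> q < p.
Proof.
case: (ltnP p k.*2) => ltp; case: (ltnP q k.*2) => ltq.
- case: (boolP (odd p)) => op; case: (boolP (odd q)) => oq; lia.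
- case: (boolP (odd p)) => op; lia.
- case: (boolP (odd q)) => oq; lia.
lia.
Qed.

Lemma wk_blocks (k p q p' q' : nat) :
  p' = (if p < k.*2 then (if odd p then p.-1 else p.+1) else p) ->
  q' = (if q < k.*2 then (if odd q then q.-1 else q.+1) else q) ->
  p' != p -> q' != q -> p' != q -> p < q -> p' < q'.
Proof.
case: (ltnP p k.*2) => ltp; case: (ltnP q k.*2) => ltq.
- case: (boolP (odd p)) => op; case: (boolP (odd q)) => oq; lia.
- case: (boolP (odd p)) => op; lia.
- case: (boolP (odd q)) => oq; lia.
lia.
Qed.

Definition moved w := [set x | w x != x].

Lemma conj_wk w : w * w = 1 ->
  exists k v, k.*2 = #|moved w| /\ w = wk n k ^ v.
Proof.
have [m] := ubnP #|moved w|; elim: m w => // m IH w lt ww.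
have wK := mulg11P ww.
have [e|/set0Pn[x]] := eqVneq (moved w) set0.
  exists 0, 1; rewrite e cards0 /wk big_ord0 conj1g; split=> //.
  apply/permP => x; rewrite perm1; apply/eqP; move/setP/(_ x): e.
  by rewrite !inE => /negbFE.
rewrite inE => wx; pose y := w x.
pose w' := w * tperm x y.
have w'x : w' x = x by rewrite permM tpermR.
have w'y : w' y = y by rewrite permM /y wK tpermL.
have w'N z : z != x -> z != y -> w' z = w z.
  move=> zx zy; rewrite permM tpermD //; last by rewrite /y (inj_eq perm_inj) eq_sym.
  by rewrite -(inj_eq (@perm_inj _ w)) wK eq_sym.
have mv : moved w = x |: (y |: moved w').
  apply/setP => z; rewrite !inE; have [->|zx] := eqVneq z x; first by rewrite wx.
  have [->|zy] := eqVneq z y; first by rewrite /y wK eq_sym wx.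
  by rewrite w'N.
have cmv : #|moved w| = #|moved w'|.+2.
  by rewrite mv !cardsU1 !inE w'x w'y !eqxx /= eq_sym (negbTE wx) /=.
have ww' : w' * w' = 1.
  apply/permP => z; rewrite permM perm1.
  have [->|zx] := eqVneq z x; first by rewrite !w'x.
  have [->|zy] := eqVneq z y; first by rewrite !w'y.
  rewrite (w'N z) // w'N ?wK //; last by rewrite /y (inj_eq perm_inj).
  by rewrite -(inj_eq (@perm_inj _ w)) wK.
have [|k [v [kE w'E]]] := IH w' _ ww'; first by move: lt; rewrite cmv; lia.
have kn : k.*2.+2 <= n.
  by rewrite kE -cmv; apply: leq_trans (max_card _) _; rewrite card_ord.
have wkfix (z : 'I_n) : (wk n k z == z) = (k.*2 <= z).
  rewrite -val_eqE /= wkE; last by lia.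
  by repeat case: ifP; move=> *; lia.
have kn1 : k.*2 < n by lia.
have kn2 : k.*2.+1 < n by lia.
pose p1 := Ordinal kn1; pose p2 := Ordinal kn2.
pose z1 := v^-1 x; pose z2 := v^-1 y.
have z12 : z1 != z2 by rewrite (inj_eq perm_inj) eq_sym.
have p12 : p1 != p2 by rewrite -val_eqE /=; lia.
have wfix (z : 'I_n) : w' z = z -> wk n k (v^-1 z) = v^-1 z.
  by move=> fz; apply: (@perm_inj _ v); rewrite -conjpE permKV -w'E.
have fz1 := wfix x w'x; have fz2 := wfix y w'y.
have fp1 : wk n k p1 = p1 by apply/eqP; rewrite wkfix.
have fp2 : wk n k p2 = p2 by apply/eqP; rewrite wkfix /=; lia.
(* Two transpositions of fixed points of [wk n k] take [p1, p2] to [z1, z2]. The second starts from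
   [p2'], where the first sends [p2], because [p2] may be [z1]. *)
pose p2' := tperm p1 z1 p2.
have fp2' : wk n k p2' = p2' by rewrite /p2'; case: tpermP => // ->.
pose t := tperm p1 z1 * tperm p2' z2.
have tp2 : t p2 = z2 by rewrite permM tpermL.
have tp1 : t p1 = z1.
  rewrite permM tpermL tpermD //; last by rewrite eq_sym.
  rewrite /p2'; case: tpermP => [e|e|_ /eqP //].
    by rewrite e eqxx in p12.
  by rewrite -e.
have twk : wk n k ^ t = wk n k.
  by rewrite /t conjgM !tpermJ_fix.
exists k.+1, (t * v); split; first by rewrite doubleS kE cmv.
rewrite wkS conjMg [in X in X * _]conjgM twk -w'E.
have -> : tpermn n k.*2 k.*2.+1 = tperm p1 p2.
  by rewrite /tpermn (insubT (fun k => k < n) kn1) (insubT (fun k => k < n) kn2).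
rewrite tpermJ !permM -[tperm _ _ (tperm _ _ p1)]permM -[tperm _ _ (tperm _ _ p2)]permM.
by rewrite -/t tp1 tp2 !permKV /w' -mulgA tperm2 mulg1.
Qed.

Lemma moved_conj w g : #|moved (w ^ g)| = #|moved w|.
Proof.
rewrite -(card_imset (moved w) (@perm_inj _ g)).
apply: eq_card => x; rewrite inE -{1 2}(permKV g x) conjpE (inj_eq perm_inj).
apply/idP/imsetP => [ne|[y]]; last by rewrite inE => ne ->; rewrite permK.
by exists (g^-1 x); rewrite ?inE ?permKV.
Qed.

Lemma ncyc2_conj w g : ncyc2 (w ^ g) = ncyc2 w.
Proof. by rewrite /ncyc2 -/(moved _) moved_conj. Qed.

Lemma ncyc2_le w : (ncyc2 w).*2 <= n.
Proof.
have : #|moved w| <= n by apply: leq_trans (max_card _) _; rewrite card_ord.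
by rewrite /ncyc2 -/(moved w); move: #|moved w| => k kn; lia.
Qed.

Lemma bigmin_leq (I : eqType) (r : seq I) d (P : pred I) (F : I -> nat) j :
  j \in r -> P j -> \big[minn/d]_(k <- r | P k) F k <= F j.
Proof.
move=> jr Pj; elim: r jr => // k r IH; rewrite inE big_cons => /orP[/eqP<-|/IH le].
  by rewrite Pj geq_minl.
by case: ifP => _ //; apply: leq_trans (geq_minr _ _) le.
Qed.

Lemma ellI_le w v : w = wk n (ncyc2 w) ^ v -> ellI w <= ell v.
Proof. by move=> /eqP e; apply: bigmin_leq; rewrite // mem_index_enum. Qed.

Lemma ellI_attained w : w * w = 1 ->
  exists2 v, w = wk n (ncyc2 w) ^ v & ell v = ellI w.
Proof.
move=> ww; have [k [v0 [kE wE]]] := conj_wk ww.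
have Pv0 : w == wk n (ncyc2 w) ^ v0 by rewrite /ncyc2 -/(moved w) -kE doubleK -wE.
case: (@arg_minnP _ v0 (fun v => w == wk n (ncyc2 w) ^ v) (@ell n) Pv0) => v /eqP Pv minv.
exists v => //; apply/eqP; rewrite eqn_leq ellI_le // andbT /ellI.
apply: (big_ind (fun m => ell v <= m)) => [|a b la lb|v' /minv //].
  exact: ell_le.
by rewrite leq_min la.
Qed.

(** For [x < y], these points are in the order favoured by [wk]: a moved point before a fixed one,
    or two moved points in the order of their images. *)
Definition up w x y := (w x != x) && ((w y == y) || (w x < w y)).

(** An optimal [v] for [w] times [sgen i] gives the upper bound. Conversely let [v] be optimal for
    [u]. If [v] places [b] before [a], then [v * s] is shorter. Otherwise the shape of [wk] places
    [u a] before [u b], although [u b < u a], so [v * t] with [t = s ^ u] is shorter; and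
    [u ^ t = u ^ s] since [s] and [t] commute. *)
Lemma ellI_up w i : w * w = 1 -> w ^ sgen i != w -> up w (lo i) (hi i) ->
  ellI (w ^ sgen i) = (ellI w).+1.
Proof.
move=> ww; set s := sgen i; set u := w ^ s => uw upw.
have uu : u * u = 1 by apply: conjg_inv.
have wK := mulg11P ww; have uK := mulg11P uu.
have ss : s * s = 1 by rewrite /s sgenE tperm2.
have wu : w = u ^ s by rewrite /u -conjgM ss conjg1.
apply/eqP; rewrite eqn_leq; apply/andP; split.
  have [v wv <-] := ellI_attained ww.
  apply: leq_trans (ell_sgen v i); apply: ellI_le.
  by rewrite ncyc2_conj conjgM -wv.
have [v uv <-] := ellI_attained uu.
suff [v' wv' lt] : exists2 v', w = wk n (ncyc2 w) ^ v' & ell v' < ell v.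
  by apply: leq_ltn_trans lt; apply: ellI_le.
pose a := lo i; pose b := hi i.
have ncu : ncyc2 u = ncyc2 w by rewrite ncyc2_conj.
have dec (c d : 'I_n) (cd : c < d) : v^-1 d < v^-1 c -> ell (v * tperm c d) < ell v.
  move=> vlt; have := @ell_tperm _ (v * tperm c d) c d cd.
  rewrite -mulgA tperm2 mulg1 invMg !permM tpermV tpermL tpermR; exact.
have wv (c : 'I_n) : wk n (ncyc2 u) (v^-1 c) = v^-1 (u c).
  by rewrite [in RHS]uv -{2}(permKV v c) conjpE permK.
have kn := ncyc2_le u.
have wkval (c : 'I_n) := wkE (v^-1 c) kn.
have ab : a < b by [].
have [lt|ge] := ltnP (v^-1 b) (v^-1 a).
  exists (v * s); last by rewrite /s sgenE dec.
  by rewrite conjgM -ncu -uv.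
have sE : s = tperm a b by rewrite /s sgenE.
have uE (c : 'I_n) : u (s c) = s (w c) by rewrite /u conjpE.
have sa : s a = b by rewrite sE tpermL.
have sb : s b = a by rewrite sE tpermR.
have ub : u b = s (w a) by rewrite -sa uE.
have ua : u a = s (w b) by rewrite -sb uE.
have [/andP[wa wba] nfix] : up w a b /\ u != w by [].
have ub' : u b != b by rewrite ub -[X in _ != X]sa (inj_eq perm_inj).
have wab : w a != b.
  apply: contra uw => /eqP wab; have wba' : w b = a by rewrite -wab wK.
  have e : s * w = w * s by rewrite conjgC sE tpermJ wab wba' tpermC.
  by rewrite /u conjgE -e mulKg.
have wba' : w b != a by rewrite -(inj_eq (@perm_inj _ w)) wK eq_sym.
have vab : v^-1 a != v^-1 b by rewrite (inj_eq perm_inj) -val_eqE /=; lia.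
have lt : v^-1 a < v^-1 b.
  by rewrite ltn_neqAle ge andbT.
have [fa|ua'] := eqVneq (u a) a.
  have e1 := wv a; have e2 := wv b; rewrite fa in e1.
  have e3 : wk n (ncyc2 u) (v^-1 b) != v^-1 b by rewrite e2 (inj_eq perm_inj).
  rewrite -val_eqE /= in e3.
  by have := wk_fix_last (wkval a) (wkval b) (congr1 val e1) e3; rewrite ltnNge ge.
have uab : u a != b by rewrite ua -{2}sa (inj_eq perm_inj).
have wb : w b != b.
  by apply: contra ua' => /eqP e; rewrite ua e sb.
have ubua : u b < u a.
  move: wba; rewrite (negbTE wb) /= => wba.
  by rewrite ub ua sE !tpermD 1?eq_sym.
pose t := tperm (u b) (u a).
have sut : s ^ u = t by rewrite sE tpermJ tpermC.
have tt : t * t = 1 by rewrite /t tperm2.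
have uba : u b != a by rewrite -(inj_eq (@perm_inj _ u)) uK eq_sym.
have ts : t * s = s * t.
  have ta : t a = a by rewrite /t tpermD // eq_sym.
  have tb : t b = b by rewrite /t tpermD // eq_sym.
  by rewrite [LHS]conjgC {2}sE tpermJ_fix.
exists (v * t); last first.
  apply: dec => //; rewrite -!wv.
  have e1 : wk n (ncyc2 u) (v^-1 a) != v^-1 a by rewrite wv (inj_eq perm_inj).
  have e2 : wk n (ncyc2 u) (v^-1 b) != v^-1 b by rewrite wv (inj_eq perm_inj).
  have e3 : wk n (ncyc2 u) (v^-1 a) != v^-1 b by rewrite wv (inj_eq perm_inj).
  rewrite -!val_eqE /= in e1 e2 e3.
  exact: (wk_blocks (wkval a) (wkval b)).
rewrite conjgM -ncu -uv wu conjgE [RHS]conjgE.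
have sV : s^-1 = s by exact: invol_inv.
have tV : t^-1 = t by exact: invol_inv.
have ut : u * t = s * u by rewrite -sut -conjgC.
have tu : t * u = u * s.
  by rewrite -sut conjgE (invol_inv uu) -mulgA -[s * u * u]mulgA uu mulg1.
by rewrite sV tV ut [RHS]mulgA ts -[RHS]mulgA tu.
Qed.

End InvLength.

(** * The Hecke relations *)

Section Types.
Local Open Scope group_scope.
Variables (n : nat).
Implicit Types (g w v u : 'S_n) (x y a b : 'I_n) (i j : 'I_n.-1).

(* For [y = x + 1] and [s] the transposition of [x] and [y]: 0 and 1 when [s]
   commutes with [w], as a descent or an ascent of [w]; 2 and 3 when [s w s] is
   above or below [w] in the involutive weak order. *)
Definition ty w x y : nat :=
  (if w x == y then 0 else if (w x == x) && (w y == y) then 1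
   else if up w x y then 2 else 3)%N.

Lemma tperm_lt a b x y : b = a.+1 :> nat -> x != y ->
  ~~ ((x \in [set a; b]) && (y \in [set a; b])) ->
  (tperm a b x < tperm a b y) = (x < y).
Proof.
move=> ab xy; rewrite !inE.
case: tpermP => [->|->|/eqP x1 /eqP x2]; case: tpermP => [->|->|/eqP y1 /eqP y2];
  rewrite ?eqxx ?orbT //= => _;
  try (rewrite -val_eqE /= in y1); try (rewrite -val_eqE /= in y2);
  try (rewrite -val_eqE /= in x1); try (rewrite -val_eqE /= in x2); lia.
Qed.

(** An adjacent transposition disturbs the comparison of [w x] and [w y] only when these are [a] and
    [b] themselves. *)
Lemma ty_conj w x y a b : b = a.+1 :> nat -> x != y ->
  ~~ [&& w x \in [set a; b], w y \in [set a; b], w x != x, w y != y & w x != y] ->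
  ty (w ^ tperm a b) (tperm a b x) (tperm a b y) = ty w x y.
Proof.
move=> ab xy; rewrite /ty /up !conjpE !(inj_eq perm_inj) => nsp.
case: (eqVneq (w x) y) nsp => // wxy.
case: (eqVneq (w x) x) => wx; case: (eqVneq (w y) y) => wy //=.
by rewrite !andbT => nsp; rewrite tperm_lt // (inj_eq perm_inj).
Qed.

Lemma ty_conj_one w x y a b : w * w = 1 -> b = a.+1 :> nat -> x != y ->
  (x \in [set a; b]) (+) (y \in [set a; b]) ->
  ty (w ^ tperm a b) (tperm a b x) (tperm a b y) = ty w x y.
Proof.
move=> ww ab xy one; apply: ty_conj => //; apply: contraL one.
have wK := mulg11P ww.
case/and5P; rewrite !inE => wxab wyab wx wy wxy.
have wne : w x != w y by rewrite (inj_eq perm_inj).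
have wyx : w y != x by rewrite -(inj_eq (@perm_inj _ w)) wK eq_sym.
case/orP: wxab => /eqP ex; case/orP: wyab => /eqP ey;
  rewrite ?ex ?ey ?eqxx // in wne wx wy wxy wyx *;
  rewrite ![x == _]eq_sym ![y == _]eq_sym (negbTE wx) (negbTE wy) (negbTE wxy) (negbTE wyx) //=.
Qed.

Lemma ty_rev w a b : w * w = 1 -> b = a.+1 :> nat -> 1 < ty w a b ->
  ty (w ^ tperm a b) a b = (5 - ty w a b)%N.
Proof.
move=> ww ab; have wK := mulg11P ww; have nab : a != b by rewrite -val_eqE /=; lia.
have wa : (w ^ tperm a b) a = tperm a b (w b) by have := conjpE w (tperm a b) b; rewrite tpermR.
have wb : (w ^ tperm a b) b = tperm a b (w a) by have := conjpE w (tperm a b) a; rewrite tpermL.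
rewrite /ty /up wa wb.
have [|wab] := eqVneq (w a) b; first by [].
have wba : w b != a by rewrite -(inj_eq (@perm_inj _ w)) wK eq_sym.
have tE c d : (tperm a b c == d) = (c == tperm a b d).
  by rewrite -{1}[d](tpermK a b) (inj_eq perm_inj).
rewrite !tE tpermL tpermR (negbTE wba).
have wne : w a != w b by rewrite (inj_eq perm_inj).
case: (eqVneq (w a) a) => fa; case: (eqVneq (w b) b) => fb //= _.
rewrite !tpermD 1?eq_sym //.
rewrite -val_eqE /= in wne.
by case: ltngtP wne.
Qed.

Lemma ty_fixE w a b : w * w = 1 -> b = a.+1 :> nat ->
  (w ^ tperm a b == w) = (ty w a b < 2).
Proof.
move=> ww ab; have wK := mulg11P ww; have nab : a != b by rewrite -val_eqE /=; lia.
apply/eqP/idP => [e|].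
  rewrite ltnNge; apply/negP => le; have := ty_rev ww ab le.
  by rewrite e; lia.
rewrite /ty; have [wab _|wab] := eqVneq (w a) b.
  have wba : w b = a by rewrite -wab wK.
  have e : tperm a b * w = w * tperm a b by rewrite conjgC tpermJ wab wba tpermC.
  by rewrite conjgE -e mulKg.
case: andP => [[/eqP fa /eqP fb] _|_]; first by apply: tpermJ_fix.
by case: ifP.
Qed.

(** Types of the three pairs among consecutive positions, read as comparisons of three letters: 0
    and 1 for equal letters, 2 and 3 for the two strict inequalities. Equal letters compare alike
    with the third, and 2 and 3 are transitive. *)
Definition consistent (r12 r13 r23 : nat) :=
  [&& r12 < 4, r13 < 4, r23 < 4, (r12 < 2) ==> (r13 == r23),
      (r23 < 2) ==> (r12 == r13),
      (r13 < 2) ==> ((r12 == r23) && (r12 < 2) || (r12 + r23 == 5)%N),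
      ~~ [&& r12 == 2, r23 == 2 & r13 == 3] &
      ~~ [&& r12 == 3, r23 == 3 & r13 == 2]].

Definition tyn (c d C D : nat) := (if C == d then 0
  else if (C == c) && (D == d) then 1
  else if (C != c) && ((D == d) || (C < D)) then 2 else 3)%N.

(** The images of [k], [k.+1], [k.+2] are kept as naturals for linear arithmetic; the three
    equations record that the map is an involution. *)
Lemma consistent_nat (k X Y Z : nat) : X != Y -> Y != Z -> X != Z ->
  (X == k.+1) = (Y == k) -> (X == k.+2) = (Z == k) -> (Y == k.+2) = (Z == k.+1) ->
  consistent (tyn k k.+1 X Y) (tyn k k.+2 X Z) (tyn k.+1 k.+2 Y Z).
Proof.
move=> xy yz xz e1 e2 e3; rewrite /tyn e1 e2 e3.
case: (eqVneq Y k) e1 => [Yk|Yk] e1.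
  have {e1} X1 : X = k.+1 by lia.
  have -> : (Z == k) = false by lia.
  have -> : (Z == k.+1) = false by lia.
  have -> : (X == k) = false by lia.
  have -> : (Y == k.+1) = false by lia.
  by rewrite /= Yk X1; case: (eqVneq Z k.+2) => Zk /=;
     rewrite ?ltnn ?(ltn_eqF (ltnSn _)) /=; repeat case: ifP; move=> *; try done; exfalso; lia.
case: (eqVneq Z k) e2 => [Zk|Zk] e2.
  have {e2} X1 : X = k.+2 by lia.
  have -> : (Z == k.+1) = false by lia.
  have -> : (X == k) = false by lia.
  have -> : (Z == k.+2) = false by lia.
  by rewrite /= Zk X1; case: (eqVneq Y k.+1) => Yk1 /=;
     repeat case: ifP; move=> *; try done; exfalso; lia.
case: (eqVneq Z k.+1) e3 => [Zk1|Zk1] e3.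
  have {e3} Y1 : Y = k.+2 by lia.
  have -> : (Y == k.+1) = false by lia.
  have -> : (Z == k.+2) = false by lia.
  by rewrite /= Zk1 Y1; case: (eqVneq X k) => Xk /=;
     repeat case: ifP; move=> *; try done; exfalso; lia.
case: (eqVneq X k) => Xk; case: (eqVneq Y k.+1) => Yk1; case: (eqVneq Z k.+2) => Zk2 //=.
all: repeat case: ifP; move=> *; try done; exfalso; lia.
Qed.

Lemma ty_consistent w (x y z : 'I_n) : w * w = 1 -> y = x.+1 :> nat -> z = y.+1 :> nat ->
  consistent (ty w x y) (ty w x z) (ty w y z).
Proof.
move=> ww yx zy; have wK := mulg11P ww.
have wE (c d : 'I_n) : (val (w c) == val d) = (val (w d) == val c).
  by rewrite !val_eqE -(inj_eq (@perm_inj _ w)) wK eq_sym.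
have ne (c d : 'I_n) : c != d :> nat -> w c != w d :> nat.
  by move=> cd; rewrite val_eqE (inj_eq perm_inj) -val_eqE.
have xz : z = x.+2 :> nat by rewrite zy yx.
have nxy : x != y :> nat by lia.
have nyz : y != z :> nat by lia.
have nxz : x != z :> nat by lia.
have := consistent_nat (k := x) (ne x y nxy) (ne y z nyz) (ne x z nxz).
by rewrite -xz -yx; apply; exact: wE.
Qed.

End Types.

Section Operators.
Local Open Scope ring_scope.
Variables (n : nat).
Implicit Types (w u : Inv n) (i j : 'I_n.-1).

Lemma InvP w : (val w * val w = 1)%g. Proof. exact/eqP/(valP w). Qed.

Lemma cj_subproof i w : ((val w ^ sgen i) * (val w ^ sgen i) == 1)%g.
Proof. by rewrite conjg_inv ?InvP. Qed.
(* [cj], and [tyI] and [opmx] below, are opaque because unification would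
   otherwise compute in the finite types. *)
Fact cj_sig : {f : 'I_n.-1 -> Inv n -> Inv n |
  forall i w, val (f i w) = (val w ^ sgen i)%g}.
Proof. by exists (fun i w => exist _ (val w ^ sgen i)%g (cj_subproof i w)). Qed.
Definition cj := sval cj_sig.

Lemma cjE i w : val (cj i w) = (val w ^ sgen i)%g.
Proof. exact: (svalP cj_sig). Qed.

Lemma sgen2 i : (sgen i * sgen i = 1)%g.
Proof. by rewrite sgenE tperm2. Qed.

Lemma cjK i : involutive (cj i).
Proof. by move=> w; apply: val_inj; rewrite !cjE -conjgM sgen2 conjg1. Qed.

Lemma cjC i j w : (i.+1 < j)%N || (j.+1 < i)%N -> cj i (cj j w) = cj j (cj i w).
Proof.
move=> far; apply: val_inj; rewrite !cjE -!conjgM; congr (_ ^ _)%g.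
rewrite [LHS]conjgC; congr (_ * _)%g; rewrite !sgenE tpermJ.
by rewrite !tpermD // -val_eqE /=; lia.
Qed.

Lemma cj_braid i j w : j = i.+1 :> nat ->
  cj i (cj j (cj i w)) = cj j (cj i (cj j w)).
Proof.
move=> ji; apply: val_inj; rewrite !cjE -!conjgM; congr (_ ^ _)%g.
have hl : hi i = lo j by apply: val_inj; rewrite /= ji.
have inv_s (k : 'I_n.-1) : ((sgen k)^-1 = sgen k)%g by apply: invol_inv; apply: sgen2.
have e1 : (sgen j ^ sgen i)%g = (sgen i ^ sgen j)%g.
  rewrite !sgenE !tpermJ -hl tpermR tpermL.
  by rewrite !tpermD //; rewrite -val_eqE /=; lia.
by move: e1; rewrite !conjgE !inv_s !mulgA.
Qed.

Fact tyI_sig : {f : 'I_n.-1 -> Inv n -> nat |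
  forall i w, f i w = ty (val w) (lo i) (hi i)}.
Proof. by exists (fun i w => ty (val w) (lo i) (hi i)). Qed.
Definition tyI := sval tyI_sig.

Lemma tyIE i w : tyI i w = ty (val w) (lo i) (hi i).
Proof. exact: (svalP tyI_sig). Qed.

Lemma tyI_lt4 i w : (tyI i w < 4)%N.
Proof. by rewrite tyIE /ty; case: ifP => // _; case: ifP => // _; case: ifP. Qed.

Lemma tyI_rev i w : (1 < tyI i w)%N -> tyI i (cj i w) = (5 - tyI i w)%N.
Proof. by rewrite !tyIE cjE sgenE => lt; rewrite ty_rev ?InvP. Qed.

Lemma cj_fix i w : (cj i w == w) = (tyI i w < 2)%N.
Proof. by rewrite tyIE -ty_fixE ?InvP // -val_eqE cjE sgenE. Qed.

(** Conjugation carries positions and types along: once [x] and [y] are exchanged, [(y, z)] has the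
    type that [(x, z)] had, and likewise for the other generator. So the type [r13] of the
    non-adjacent pair governs the second step on both sides. *)
Lemma tyI_braid i j w : j = i.+1 :> nat ->
  exists r13, [/\ consistent (tyI i w) r13 (tyI j w),
    tyI j (cj i w) = r13, tyI i (cj j w) = r13,
    tyI i (cj j (cj i w)) = tyI j w & tyI j (cj i (cj j w)) = tyI i w].
Proof.
move=> ji; have hl : hi i = lo j by apply: val_inj; rewrite /= ji.
set x := lo i; set y := hi i; set z := hi j.
have yx : y = x.+1 :> nat by [].
have zy : z = y.+1 :> nat by rewrite /= ji.
have xy : x != y by rewrite -val_eqE /=; lia.
have yz : y != z by rewrite -val_eqE /= ji; lia.
have xz : x != z by rewrite -val_eqE /= ji; lia.
have ww := InvP w; have w1 := InvP (cj i w); have w2 := InvP (cj j w).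
have si : sgen i = tperm x y by rewrite sgenE.
have sj : sgen j = tperm y z by rewrite sgenE -hl.
have six : tperm x y x = y by rewrite tpermL.
have siy : tperm x y y = x by rewrite tpermR.
have siz : tperm x y z = z by rewrite tpermD.
have sjx : tperm y z x = x by rewrite tpermD // eq_sym.
have sjy : tperm y z y = z by rewrite tpermL.
have sjz : tperm y z z = y by rewrite tpermR.
have neF : ((x == z) = false) * ((z == x) = false) * ((x == y) = false)
         * ((y == x) = false) * ((y == z) = false) * ((z == y) = false).
  by rewrite ![_ == x]eq_sym ![z == _]eq_sym (negbTE xy) (negbTE yz) (negbTE xz).
have A v : (v * v = 1)%g -> ty (v ^ tperm x y) y z = ty v x z.
  move=> vv; have := @ty_conj_one n v x z x y vv yx xz; rewrite six siz; apply.
  by rewrite !inE !eqxx ?orbT ?neF.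
have B v : (v * v = 1)%g -> ty (v ^ tperm y z) x y = ty v x z.
  move=> vv; have := @ty_conj_one n v x z y z vv zy xz; rewrite sjx sjz; apply.
  by rewrite !inE !eqxx ?orbT ?neF.
have C v : (v * v = 1)%g -> ty (v ^ tperm x y) x z = ty v y z.
  move=> vv; have := @ty_conj_one n v y z x y vv yx yz; rewrite siy siz; apply.
  by rewrite !inE !eqxx ?orbT ?neF.
have D v : (v * v = 1)%g -> ty (v ^ tperm y z) x z = ty v x y.
  move=> vv; have := @ty_conj_one n v x y y z vv zy xy; rewrite sjx sjy; apply.
  by rewrite !inE !eqxx ?orbT ?neF.
exists (ty (val w) x z); rewrite !tyIE !cjE -hl -/x -/y -/z si sj.
rewrite cjE si in w1; rewrite cjE sj in w2.
by split; rewrite ?A ?B ?C ?D //; apply: ty_consistent.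
Qed.

(* Two distant generators either move [w] independently or, when [w] maps the
   pair of positions of one onto that of the other, act on [w] identically. *)
Lemma tyI_far i j w : (i.+1 < j)%N || (j.+1 < i)%N ->
  [/\ tyI i (cj j w) = tyI i w, tyI j (cj i w) = tyI j w & True] \/
  [/\ tyI i w = tyI j w, cj i w = cj j w & (1 < tyI i w)%N].
Proof.
move=> far; have ww := InvP w; have wK := mulg11P ww.
set W := val w in ww wK *.
have ne : [/\ lo i != lo j, lo i != hi j, hi i != lo j & hi i != hi j].
  by rewrite -!val_eqE /=; split; lia.
have [n1 n2 n3 n4] := ne.
have nl i' : lo i' != hi i' := lo_hi i'.
have WE k l : W k = l -> W l = k by move=> <-; rewrite wK.
have csij : (sgen i * sgen j = sgen j * sgen i)%g.
  by rewrite [LHS]conjgC; congr (_ * _)%g; rewrite !sgenE tpermJ !tpermD // eq_sym.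
have [/andP[sp1 sp2]|nsp] := boolP ((W (lo j) \in [set lo i; hi i]) &&
   (W (hi j) \in [set lo i; hi i])).
  right; move: sp1 sp2; rewrite !inE => sp1 sp2.
  have ne' : W (lo j) != W (hi j) by rewrite (inj_eq perm_inj).
  have [[e1 e2]|[e1 e2]] : (W (lo j) = lo i /\ W (hi j) = hi i) \/
                           (W (lo j) = hi i /\ W (hi j) = lo i).
  - by move: sp1 sp2 ne' => /orP[] /eqP-> /orP[] /eqP->; rewrite ?eqxx //; auto.
  - have e3 := WE _ _ e1; have e4 := WE _ _ e2.
    have sW : (W * sgen i = sgen j * W)%g by rewrite [RHS]conjgC !sgenE tpermJ e1 e2.
    have sW' : (W * sgen j = sgen i * W)%g by rewrite [RHS]conjgC !sgenE tpermJ e3 e4.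
    have ti : tyI i w = 2%N.
      rewrite tyIE -/W /ty /up e3 e4 ![lo j == _]eq_sym ![hi j == _]eq_sym.
      by rewrite (negbTE n1) (negbTE n3) (negbTE n4) /= ltnSn.
    have tj : tyI j w = 2%N.
      by rewrite tyIE -/W /ty /up e1 e2 (negbTE n1) (negbTE n2) (negbTE n4) /= ltnSn.
    rewrite ti tj; split=> //; apply: val_inj.
    rewrite !cjE -/W !conjgE !(invol_inv (sgen2 _)).
    by rewrite sW sW' !mulgA csij.
  - have e3 := WE _ _ e1; have e4 := WE _ _ e2.
    have sW : (W * sgen i = sgen j * W)%g by rewrite [RHS]conjgC !sgenE tpermJ e1 e2 tpermC.
    have sW' : (W * sgen j = sgen i * W)%g by rewrite [RHS]conjgC !sgenE tpermJ e3 e4 tpermC.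
    have ti : tyI i w = 3%N.
      rewrite tyIE -/W /ty /up e3 e4 ![lo j == _]eq_sym ![hi j == _]eq_sym.
      by rewrite !(negbTE n2, negbTE n3, negbTE n4) /= ltnNge leqnSn.
    have tj : tyI j w = 3%N.
      by rewrite tyIE -/W /ty /up e1 e2 (negbTE n4) (negbTE n3) (negbTE n2) /= ltnNge leqnSn.
    rewrite ti tj; split=> //; apply: val_inj.
    rewrite !cjE -/W !conjgE !(invol_inv (sgen2 _)).
    by rewrite sW sW' !mulgA csij.
left; split => //.
- rewrite !tyIE cjE [sgen j]sgenE.
  have := @ty_conj n W (lo i) (hi i) (lo j) (hi j) erefl (nl i).
  rewrite !tpermD 1?eq_sym //; apply.
  apply: contra nsp; rewrite !inE => /and5P[p1 p2 _ _ _].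
  have ne' : W (lo i) != W (hi i) by rewrite (inj_eq perm_inj).
  by move: p1 p2 ne' => /orP[] /eqP p1 /orP[] /eqP p2; rewrite p1 p2 ?eqxx //;
    rewrite (WE _ _ p1) (WE _ _ p2) !eqxx ?orbT.
rewrite !tyIE cjE [sgen i]sgenE.
have := @ty_conj n W (lo j) (hi j) (lo i) (hi i) erefl (nl j).
rewrite !tpermD //; apply.
by apply: contra nsp => /and5P[-> ->].
Qed.

(* The three kinds of relations are those of the standard action of the Hecke
   algebra on words, [ty] telling how two consecutive letters compare; the
   off-diagonal entries [c2], [c3] only matter through their product [q]. *)
Variables (R : comNzRingType) (q c2 c3 : R).
Hypothesis c23 : c2 * c3 = q.

Definition ca (t : nat) : R := nth 0 [:: - q; 1; 1 - q; 0] t.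
Definition cb (t : nat) : R := nth 0 [:: 0; 0; c2; c3] t.

Fact opmx_sig : {f : 'I_n.-1 -> 'M[R]_(Nn n) | forall i a b,
  f i a b = ca (tyI i (enum_val a)) * (enum_val b == enum_val a)%:R
     + cb (tyI i (enum_val a)) * (enum_val b == cj i (enum_val a))%:R}.
Proof.
exists (fun i => \matrix_(a, b)
    (ca (tyI i (enum_val a)) * (enum_val b == enum_val a)%:R
     + cb (tyI i (enum_val a)) * (enum_val b == cj i (enum_val a))%:R)).
by move=> i a b; rewrite mxE.
Qed.
(** The parameters [q q 1] give [rho], [q qhalf qhalf] its symmetric form, ['X ^+ 2, 'X, 'X] the
    polynomial lift of the latter, and [1 1 1] the specialization. *)
Definition opmx := sval opmx_sig.

Lemma opmxE i a b : opmx i a b = ca (tyI i (enum_val a)) * (enum_val b == enum_val a)%:R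
     + cb (tyI i (enum_val a)) * (enum_val b == cj i (enum_val a))%:R.
Proof. exact: (svalP opmx_sig). Qed.

Definition ev w : 'rV[R]_(Nn n) := delta_mx 0 (enum_rank w).

Lemma ev_opmx i w :
  ev w *m opmx i = ca (tyI i w) *: ev w + cb (tyI i w) *: ev (cj i w).
Proof.
rewrite /ev -rowE; apply/rowP => b; rewrite !mxE opmxE enum_rankK.
by rewrite !(can2_eq (@enum_valK _) (@enum_rankK _)) /=.
Qed.

Lemma eq_ev m (A B : 'M[R]_(Nn n, m)) :
  (forall w, ev w *m A = ev w *m B) -> A = B.
Proof.
move=> eqAB; apply/row_matrixP => a.
by rewrite !rowE -(enum_valK a); apply: eqAB.
Qed.

Lemma opmx_quadratic i : (opmx i + q%:M) *m (opmx i - 1%:M) = 0.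
Proof.
apply: eq_ev => w; rewrite mulmx0 mulmxA [ev w *m _]mulmxDr ev_opmx mulmxBr mulmx1.
rewrite mul_mx_scalar !mulmxDl -!scalemxAl !ev_opmx cjK.
have := tyI_lt4 i w; have := @tyI_rev i w.
case: (tyI i w) => [|[|[|[|//]]]] rev _; try rewrite (rev isT);
  rewrite /ca /cb /=; apply/rowP => k; rewrite !mxE -?c23; ring.
Qed.

Lemma comm_rows N (A B : 'M[R]_N) (v vs vt vst : 'rV[R]_N) (a b c d : R) :
  v *m A = a *: v + b *: vs -> v *m B = c *: v + d *: vt ->
  vs *m B = c *: vs + d *: vst -> vt *m A = a *: vt + b *: vst ->
  v *m (A *m B) = v *m (B *m A).
Proof.
move=> vA vB vsB vtA; rewrite !mulmxA vA vB !mulmxDl -!scalemxAl vA vB vsB vtA.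
by apply/rowP => k; rewrite !mxE; ring.
Qed.

Lemma opmx_comm i j : (i.+1 < j)%N || (j.+1 < i)%N ->
  opmx i *m opmx j = opmx j *m opmx i.
Proof.
move=> far; apply: eq_ev => w.
case: (tyI_far w far) => [[ti tj _]|[t c lt]].
  apply: (comm_rows (ev_opmx i w) (ev_opmx j w)).
    by rewrite ev_opmx tj.
  by rewrite ev_opmx ti (cjC w far).
have e : ev w *m opmx j = ev w *m opmx i by rewrite !ev_opmx -c -t.
have e' : ev (cj i w) *m opmx j = ev (cj i w) *m opmx i.
  have t' : tyI j (cj i w) = tyI i (cj i w) by rewrite {1}c (tyI_rev lt) tyI_rev -t.
  have c' : cj j (cj i w) = cj i (cj i w) by rewrite {1}c !cjK.
  by rewrite (ev_opmx j) (ev_opmx i) t' c'.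
rewrite [LHS]mulmxA [RHS]mulmxA e (ev_opmx i w) [LHS]mulmxDl [RHS]mulmxDl.
by rewrite -!scalemxAl e e'.
Qed.

(** If [r12 < 2] then [r21] is left free, but it only occurs multiplied by [cb r12 = 0]; likewise
    for [r32]. *)
Lemma braid_coefs r12 r13 r23 r21 r32 : consistent r12 r13 r23 ->
  ((1 < r12)%N -> r21 = (5 - r12)%N) -> ((1 < r23)%N -> r32 = (5 - r23)%N) ->
  [/\ ca r12 * ca r12 * ca r23 + cb r12 * cb r21 * ca r13
       - (ca r23 * ca r23 * ca r12 + cb r23 * cb r32 * ca r13) = 0,
      cb r12 * (ca r12 * ca r23 + ca r13 * ca r21 - ca r23 * ca r13) = 0
    & cb r23 * (ca r12 * ca r13 - ca r23 * ca r12 - ca r13 * ca r32) = 0].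
Proof.
case: r12 => [|[|[|[|//]]]]; case: r13 => [|[|[|[|//]]]];
  case: r23 => [|[|[|[|//]]]] //= _ r21E r32E;
  try rewrite (r21E isT); try rewrite (r32E isT);
  rewrite /ca /cb /= -?c23; split; ring.
Qed.

(** In the two expansions the coefficients of [vst], [vts] and [vx] agree identically, which leaves
    three equations. The vectors may coincide, as they do when conjugation fixes an involution. *)
Lemma braid_rows N (A B : 'M[R]_N) (v vs vt vts vst vx : 'rV[R]_N)
    (a12 b12 a23 b23 a21 b21 a32 b32 a13 b13 : R) :
  v *m A = a12 *: v + b12 *: vs -> v *m B = a23 *: v + b23 *: vt ->
  vs *m A = a21 *: vs + b21 *: v -> vt *m B = a32 *: vt + b32 *: v ->
  vs *m B = a13 *: vs + b13 *: vst -> vt *m A = a13 *: vt + b13 *: vts ->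
  vst *m A = a23 *: vst + b23 *: vx -> vts *m B = a12 *: vts + b12 *: vx ->
  [/\ a12 * a12 * a23 + b12 * b21 * a13
       - (a23 * a23 * a12 + b23 * b32 * a13) = 0,
      b12 * (a12 * a23 + a13 * a21 - a23 * a13) = 0
    & b23 * (a12 * a13 - a23 * a12 - a13 * a32) = 0] ->
  v *m (A *m B *m A) = v *m (B *m A *m B).
Proof.
move=> vA vB vsA vtB vsB vtA vstA vtsB [e0 e1 e2]; rewrite !mulmxA vA vB.
repeat (progress rewrite ?mulmxDl -?scalemxAl ?(vA, vB, vsA, vtB, vsB, vtA, vstA, vtsB)).
apply/eqP; rewrite -subr_eq0; apply/eqP.
rewrite -[RHS](scale0r v) -[RHS]addr0 -[X in _ = _ + X](scale0r vs).
rewrite -[RHS]addr0 -[X in _ = _ + X](scale0r vt) -{1}e0 -{1}e1 -{1}e2.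
by apply/rowP => k; rewrite !mxE; ring.
Qed.

Lemma opmx_braid i j : j = i.+1 :> nat ->
  opmx i *m opmx j *m opmx i = opmx j *m opmx i *m opmx j.
Proof.
move=> ji; apply: eq_ev => w.
have [r13 [cons r1 r2 r3 r4]] := tyI_braid w ji.
apply: (braid_rows (ev_opmx i w) (ev_opmx j w) _ _ _ _ _ _
  (braid_coefs cons (@tyI_rev i w) (@tyI_rev j w))).
- by rewrite ev_opmx cjK.
- by rewrite ev_opmx cjK.
- by rewrite ev_opmx r1.
- by rewrite ev_opmx r2.
- by rewrite ev_opmx r3 cj_braid.
- by rewrite ev_opmx r4.
Qed.

End Operators.

(** * The operators [rho] and their symmetrization *)

Section Rho.
Local Open Scope ring_scope.
Variables (n : nat).
Implicit Types (w u : Inv n) (i j : 'I_n.-1).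

Lemma ellI_cj i w : tyI i w = 2%N -> ellI (val (cj i w)) = (ellI (val w)).+1.
Proof.
move=> ti; rewrite cjE ellI_up ?InvP //.
  by rewrite -cjE val_eqE cj_fix ti.
by move: ti; rewrite tyIE /ty; case: ifP => // _; case: ifP => // _; case: ifP.
Qed.

Lemma ellI_cj3 i w : tyI i w = 3%N -> ellI (val w) = (ellI (val (cj i w))).+1.
Proof.
move=> ti; have : tyI i (cj i w) = 2%N by rewrite tyI_rev ti.
by move/ellI_cj; rewrite cjK.
Qed.

Lemma leI_ell w u : leI w u -> (ellI (val w) <= ellI (val u))%N.
Proof.
move=> /connectP[p]; elim: p w => [|v p IH] w /=; first by move=> _ ->.
case/andP => /existsP[i /andP[_ /eqP e]] pth lst.
by apply: leq_trans (IH v pth lst); rewrite e leqnSn.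
Qed.

Lemma covI_cj i w : tyI i w = 2%N -> ltI w (cj i w).
Proof.
move=> ti; rewrite /ltI eq_sym cj_fix ti /=; apply: connect1.
by apply/existsP; exists i; rewrite cjE eqxx -cjE ellI_cj ?eqxx.
Qed.

Lemma rhoE i : rho i = opmx q q 1 i.
Proof.
apply/matrixP => a b; rewrite opmxE mxE /rho_coef.
set w := enum_val a; set u := enum_val b.
have eval : (val w ^ sgen i == val w)%g = (tyI i w < 2)%N.
  by rewrite -cj_fix -cjE val_eqE.
have evu : (val u == val w ^ sgen i)%g = (u == cj i w) by rewrite -cjE val_eqE.
have exP (P : Inv n -> Inv n -> bool) :
    [exists w' : Inv n, (val w' == val w ^ sgen i)%g && P w w'] = P w (cj i w).
  apply/existsP/idP => [[w' /andP[]]|Pw].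
    by rewrite -cjE val_eqE => /eqP->.
  by exists (cj i w); rewrite cjE eqxx.
rewrite eval evu (exP (@ltI n)) (exP (fun w w' => ltI w' w)).
have := tyI_lt4 i w; case ti : (tyI i w) => [|[|[|[|//]]]] _ /=.
- have -> : des i (val w).
    move: ti; rewrite desE tyIE /ty; case: eqP => [e _|]; last by case: ifP => //; case: ifP.
    by rewrite e -{1}e (mulg11P (InvP w)) /=.
  by rewrite /ca /cb /= mul0r addr0 mulr_natr; case: eqP.
- have -> : des i (val w) = false.
    move: ti; rewrite desE tyIE /ty; case: eqP => // _; case: andP => [[/eqP-> /eqP->] _|_].
      by rewrite ltnNge leqnSn.
    by case: ifP.
  by rewrite /ca /cb /= mul0r addr0 mulr_natr; case: eqP.
- rewrite covI_cj // /ca /cb /= !mulr_natr.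
  by case: eqP; case: eqP.
have -> : ltI w (cj i w) = false.
  apply/negbTE/negP => /andP[_ /leI_ell].
  by rewrite (ellI_cj3 ti) ltnn.
have -> : ltI (cj i w) w.
  by rewrite -{2}(cjK i w) covI_cj // tyI_rev ti.
by rewrite /ca /cb /= mul0r add0r mul1r; case: eqP.
Qed.

Lemma rmorph_comb2 (R S : pzRingType) (f : {rmorphism R -> S}) (x y : R) (k l : nat) :
  f (x * k%:R + y * l%:R) = f x * k%:R + f y * l%:R.
Proof. by rewrite rmorphD !rmorphM !rmorph_nat. Qed.

Lemma map_opmx (R S : comNzRingType) (f : {rmorphism R -> S}) (q0 c2 c3 : R) i :
  map_mx f (@opmx n R q0 c2 c3 i) = opmx (f q0) (f c2) (f c3) i.
Proof.
apply/matrixP => a b; rewrite [LHS]mxE (opmxE _ _ _ i a b) (opmxE _ _ _ i a b).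
rewrite (rmorph_comb2 f).
have := tyI_lt4 i (enum_val a).
by case: (tyI i (enum_val a)) => [|[|[|[|//]]]] _;
   rewrite /ca /cb /= ?rmorphN ?rmorphB ?rmorph1 ?rmorph0.
Qed.

Lemma opmx_sym (R : comNzRingType) (q0 c : R) i :
  (@opmx n R q0 c c i)^T = opmx q0 c c i.
Proof.
apply/matrixP => a b.
rewrite [LHS]mxE (opmxE _ _ _ i a b) (opmxE _ _ _ i b a).
set w := enum_val a; set u := enum_val b.
have eab : (a == b) = (w == u) by rewrite (inj_eq enum_val_inj).
have [-> //|wu] := eqVneq w u.
rewrite !mulr0 !add0r.
have -> : (w == cj i u) = (u == cj i w).
  by apply/eqP/eqP => ->; rewrite cjK.
have [e|_] := eqVneq u (cj i w); last by rewrite !mulr0.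
rewrite !mulr1; have lt : (1 < tyI i w)%N.
  by rewrite ltnNge -ltnS -cj_fix -e eq_sym.
have := tyI_lt4 i w; rewrite e tyI_rev //.
by case: (tyI i w) lt => [|[|[|[|//]]]].
Qed.

(** A covering changes [ellI] by exactly 1, so this scaling turns the off-diagonal entries [q] and 1
    into [qhalf] twice. *)
Definition ell_diag : 'M[Fq]_(Nn n) :=
  diag_mx (\row_a qhalf ^+ ellI (val (enum_val a))).

Lemma ev_ell_diag w : ev Fq w *m ell_diag = qhalf ^+ ellI (val w) *: ev Fq w.
Proof.
rewrite /ev -rowE row_diag_mx mxE enum_rankK //.
Qed.

Lemma qhalf_neq0 : qhalf != 0.
Proof. by rewrite /qhalf tofrac_eq0 polyX_eq0. Qed.

Lemma ell_diag_unit : ell_diag \in unitmx.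
Proof.
rewrite unitmxE det_diag unitfE; apply/prodf_neq0 => a _.
by rewrite mxE expf_neq0 // qhalf_neq0.
Qed.

Lemma conj_rows (R : comNzRingType) N (D A B : 'M[R]_N) (v v' : 'rV[R]_N)
    (x y a b b' : R) :
  v *m D = x *: v -> v' *m D = y *: v' -> v *m A = a *: v + b *: v' ->
  v *m B = a *: v + b' *: v' -> x * b = b' * y -> v *m (D *m A) = v *m (B *m D).
Proof.
move=> vD v'D vA vB xb; rewrite !mulmxA vD vB mulmxDl -!scalemxAl vA vD v'D.
by rewrite scalerDr !scalerA xb [x * a]mulrC.
Qed.

Lemma expr_mul_sqr (R : comNzRingType) (x : R) l : x ^+ l * x ^+ 2 = x * x ^+ l.+1.
Proof. by rewrite -exprD -exprS addn2. Qed.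

Lemma exprS_mul1 (R : comNzRingType) (x : R) l : x ^+ l.+1 * 1 = x * x ^+ l.
Proof. by rewrite mulr1 exprS. Qed.

Lemma ell_diag_rho i : ell_diag *m rho i = opmx q qhalf qhalf i *m ell_diag.
Proof.
rewrite rhoE; apply: eq_ev => w.
apply: (conj_rows (ev_ell_diag w) (ev_ell_diag (cj i w))
  (ev_opmx q q 1 i w) (ev_opmx q qhalf qhalf i w)).
have := tyI_lt4 i w; case ti : (tyI i w) => [|[|[|[|//]]]] _; rewrite /cb.
- by rewrite mulr0 mul0r.
- by rewrite mulr0 mul0r.
- by rewrite ellI_cj //; exact: (expr_mul_sqr qhalf).
by rewrite (ellI_cj3 ti); exact: (exprS_mul1 qhalf).
Qed.

End Rho.

(** * Words *)

Section Words.
Local Open Scope ring_scope.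
Variables (n : nat).
Implicit Types (w u : Inv n) (i j : 'I_n.-1) (g : 'S_n) (s : seq 'I_n.-1).

Definition wperm s : 'S_n := foldr (fun i g => sgen i * g)%g 1%g s.

Lemma wperm_cat s1 s2 : wperm (s1 ++ s2) = (wperm s1 * wperm s2)%g.
Proof. by elim: s1 => [|i s1 IH] /=; rewrite ?mul1g // IH mulgA. Qed.

Lemma word_tperm (x y : 'I_n) : (x < y)%N -> exists s, wperm s = tperm x y.
Proof.
have [d] := ubnP (y - x); elim: d x y => // d IH x y le xy.
have iN : (y.-1 < n.-1)%N by have := ltn_ord y; lia.
pose i := Ordinal iN.
have hiy : hi i = y by apply: val_inj => /=; lia.
have [lt|ge] := ltnP x y.-1; last first.
  have lox : lo i = x by apply: val_inj => /=; lia.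
  by exists [:: i]; rewrite /= mulg1 sgenE hiy lox.
have [||s sE] := IH x (lo i) => //=; first by lia.
exists (i :: s ++ [:: i]); rewrite /= wperm_cat sE /= mulg1.
have xl : x != lo i by rewrite -val_eqE /=; lia.
have xh : x != hi i by rewrite -val_eqE /=; lia.
have -> : (sgen i * (tperm x (lo i) * sgen i) = tperm x (lo i) ^ sgen i)%g.
  by rewrite conjgE (invol_inv (sgen2 i)).
by rewrite sgenE tpermJ tpermL tpermD 1?eq_sym ?hiy // -hiy.
Qed.

Lemma word_exists g : exists s, wperm s == g.
Proof.
have [ts -> _] := prod_tpermP g.
elim: ts => [|[x y] ts [s /eqP IH]]; first by exists [::]; rewrite big_nil.
suff [s1 s1E] : exists s1, wperm s1 = tperm x y.
  by exists (s1 ++ s); rewrite big_cons wperm_cat IH s1E.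
case: (ltngtP x y) => [/word_tperm //|/word_tperm|/val_inj ->].
  by rewrite tpermC.
by exists [::]; rewrite tperm1.
Qed.

Definition word g := xchoose (word_exists g).

Lemma wordE g : wperm (word g) = g.
Proof. exact/eqP/(xchooseP (word_exists g)). Qed.

Definition wmx (R : nzRingType) d (A : 'I_n.-1 -> 'M[R]_d) s : 'M[R]_d :=
  foldr (fun i B => A i *m B) 1%:M s.

Lemma wmx_cat (R : nzRingType) d (A : 'I_n.-1 -> 'M[R]_d) s1 s2 :
  wmx A (s1 ++ s2) = wmx A s1 *m wmx A s2.
Proof. by elim: s1 => [|i s1 IH] /=; rewrite ?mul1mx // IH mulmxA. Qed.

Lemma wmx_comm (R : nzRingType) d (A : 'I_n.-1 -> 'M[R]_d) m
    (B : 'I_n.-1 -> 'M[R]_m) (X : 'M_(d, m)) s :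
  (forall i, A i *m X = X *m B i) -> wmx A s *m X = X *m wmx B s.
Proof.
move=> AX; elim: s => [|i s IH] /=; first by rewrite mul1mx mulmx1.
by rewrite -mulmxA IH !mulmxA AX.
Qed.

Lemma map_wmx (R S : nzRingType) (f : {rmorphism R -> S}) d
    (A : 'I_n.-1 -> 'M[R]_d) s :
  map_mx f (wmx A s) = wmx (fun i => map_mx f (A i)) s.
Proof. by elim: s => [|i s IH] /=; rewrite ?map_mx1 // map_mxM IH. Qed.

Lemma eq_wmx (R : nzRingType) d (A B : 'I_n.-1 -> 'M[R]_d) s :
  A =1 B -> wmx A s = wmx B s.
Proof. by move=> AB; elim: s => //= i s ->; rewrite AB. Qed.

Lemma cjg_subproof g w : ((val w ^ g) * (val w ^ g) == 1)%g.
Proof. by rewrite conjg_inv ?InvP. Qed.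
Definition cjg g w : Inv n := exist _ (val w ^ g)%g (cjg_subproof g w).

(** An adjacent transposition reverses the order of no pair but its own. *)
Lemma sg_sgen i w : sg (sgen i) (val w) = (tyI i w == 0%N).
Proof.
have wK := mulg11P (InvP w).
have ltlh : (lo i < hi i)%N by [].
have -> : (tyI i w == 0%N) = (val w (lo i) == hi i).
  rewrite tyIE /ty; case: (val w (lo i) == hi i) => //.
  by case: ifP => [//|_]; case: ifP.
rewrite /sg big_mkcond sgenE /=.
transitivity (\big[addb/false]_(x | x == lo i) (val w (lo i) == hi i)).
  rewrite [RHS]big_mkcond; apply: eq_bigr => x _ /=.
  case: ifP => lt; last first.
    case: eqP => // ex; apply/esym/negbTE; apply: contraFN lt => /eqP e.
    by rewrite ex e.
  have ab : hi i = (lo i).+1 :> nat by [].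
  have xw : val w x != x by rewrite -val_eqE /=; lia.
  have [/andP[x1 x2]|out] := boolP ((val w x \in [set lo i; hi i]) && (x \in [set lo i; hi i])).
    move: x1 x2 lt xw; rewrite !inE => /orP[]/eqP e1 /orP[]/eqP e2;
      rewrite ?e1 e2 ?eqxx ?ltnn //=.
    - by rewrite ltnNge leqnSn.
    - by move=> _ _; rewrite -e2 e1 tpermL tpermR e2 !eqxx ltnSn.
  rewrite (tperm_lt ab xw) // ltnNge ltnW //=.
  case: eqP => // ex; apply/esym/negbTE; apply: contra out => /eqP e.
  by rewrite ex e !inE !eqxx orbT.
by rewrite big_pred1_eq.
Qed.

Variable R : comNzRingType.
Let M i : 'M[R]_(Nn n) := opmx 1 1 1 i.

Lemma ev_signed i w :
  ev R w *m M i = (-1) ^+ sg (sgen i) (val w) *: ev R (cj i w).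
Proof.
rewrite ev_opmx sg_sgen.
have := cj_fix i w; have := tyI_lt4 i w.
case: (tyI i w) => [|[|[|[|//]]]] _ /=; rewrite /ca /cb /= ?expr0 ?expr1 ?subrr.
- by move/eqP->; rewrite scale0r addr0.
- by move/eqP->; rewrite scale0r addr0.
- by rewrite scale0r add0r.
by rewrite scale0r add0r.
Qed.

Lemma ev_signed_word s w :
  ev R w *m wmx M s = (-1) ^+ sg (wperm s) (val w) *: ev R (cjg (wperm s) w).
Proof.
elim: s w => [|i s IH] w /=.
  rewrite mulmx1 sg1 expr0 scale1r; congr (ev _ _).
  by apply: val_inj; rewrite /= conjg1.
rewrite mulmxA ev_signed -scalemxAl IH scalerA sgM ?InvP // signr_addb cjE.
congr (_ *: ev _ _).
by apply: val_inj; rewrite /= cjE conjgM.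
Qed.

Lemma ev_entry w (X : 'M[R]_(Nn n)) b : (ev R w *m X) 0 b = X (enum_rank w) b.
Proof. by rewrite /ev -rowE mxE. Qed.

End Words.

Section One.
Local Open Scope ring_scope.
Variables (n : nat).
Let M i : 'M[rat]_(Nn n) := opmx 1 1 1 i.

Lemma words_free_one (c : 'S_n -> rat) :
  \sum_g c g *: wmx M (word g) = 0 -> forall g, c g = 0.
Proof.
move=> c0 g; apply/eqP; rewrite -(fmorph_eq0 (ratr : rat -> algC)); apply/eqP.
apply: (@signed_inv_free n (fun g => ratr (c g))) => w u /eqP ww /eqP uu.
pose w' : Inv n := exist _ w ww; pose u' : Inv n := exist _ u uu.
have := congr1 (fun X : 'M_(Nn n) => (ev rat w' *m X) 0 (enum_rank u')) c0.
rewrite mulmx0 mulmx_sumr summxE [RHS]mxE => e.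
have := congr1 (ratr : rat -> algC) e; rewrite rmorph0 rmorph_sum => {}e; rewrite -[RHS]e.
rewrite big_mkcond /=.
apply: eq_bigr => h _.
rewrite -scalemxAr ev_signed_word wordE !mxE rmorphM rmorphM rmorph_sign.
rewrite eqxx /= (inj_eq enum_rank_inj) [u' == _]eq_sym.
have -> : (cjg h w' == u') = (w ^ h == u)%g by rewrite -val_eqE.
by rewrite rmorph_nat mulrA; case: ifP; rewrite ?mulr1 ?mulr0.
Qed.

Lemma commutant_one_sym (Z : 'M[rat]_(Nn n)) :
  (forall i, M i *m Z = Z *m M i) -> Z^T = Z.
Proof.
move=> comZ.
pose a (w u : 'S_n) : rat :=
  if insub w is Some w' then
    if insub u is Some u' then Z (enum_rank (w' : Inv n)) (enum_rank (u' : Inv n)) else 0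
  else 0.
have aE (w u : Inv n) : a (val w) (val u) = Z (enum_rank w) (enum_rank u).
  by rewrite /a !valK.
apply/matrixP => i j; rewrite mxE -(enum_valK i) -(enum_valK j) -!aE.
apply: (@equivariant_sym n _ [set: 'I_n] a); try exact: InvP;
  try by apply/subsetP.
move=> g w u _ _ _ /eqP ww /eqP uu.
pose w' : Inv n := exist _ w ww; pose u' : Inv n := exist _ u uu.
have -> : a (w ^ g)%g (u ^ g)%g = Z (enum_rank (cjg g w')) (enum_rank (cjg g u')).
  by rewrite -aE.
have -> : a w u = Z (enum_rank w') (enum_rank u') by rewrite -aE.
have := congr1 (fun X => (ev rat w' *m X) 0 (enum_rank (cjg g u')))
  (wmx_comm (word g) comZ).
rewrite !mulmxA ev_signed_word wordE -scalemxAl mxE ev_entry => ->.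
rewrite mxE (bigD1 (enum_rank u')) //= big1 => [|k ne].
  by rewrite addr0 ev_entry -(ev_entry u') ev_signed_word wordE !mxE !eqxx mulr1.
rewrite -{2}(enum_valK k) -(ev_entry (enum_val k)) ev_signed_word wordE !mxE.
rewrite eqxx (inj_eq enum_rank_inj) /=.
have [e|] := eqVneq (cjg g u') (cjg g (enum_val k)); last by rewrite !mulr0.
case/eqP: ne; apply: (canRL (@enum_valK _)); apply: val_inj.
by have := congr1 val e; rewrite /= => /conjg_inj.
Qed.

End One.

(** * Specialization and anisotropy of Q(qhalf) *)

Section Fractions.
Local Open Scope ring_scope.
Local Open Scope quotient_scope.

Notation tofracq := (@FracField.tofrac {poly rat}).
Notation "p %:F" := (tofracq p).
Notation ev1 := (horner_eval (1 : rat)).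

Lemma fracP (x : Fq) : exists2 d : {poly rat}, d != 0 & exists p, x * d%:F = p%:F.
Proof.
elim/quotW: x => r; exists \d_r; first exact: denom_ratioP.
exists \n_r; unlock FracField.tofrac; rewrite -[LHS]FracField.pi_mul.
apply/eqmodP; rewrite /= FracField.equivfE /FracField.mulf /=.
rewrite !numden_Ratio ?mulf_neq0 ?denom_ratioP ?oner_neq0 //.
by rewrite !mulr1 mulrC.
Qed.

Lemma common_denom (s : seq Fq) : exists2 d : {poly rat}, d != 0 &
  forall x, x \in s -> exists p, d%:F * x = p%:F.
Proof.
elim: s => [|x s [d d0 IH]]; first by exists 1; rewrite ?oner_eq0.
have [e e0 [p xp]] := fracP x.
exists (d * e); first by rewrite mulf_neq0.
move=> y; rewrite inE => /orP[/eqP->|/IH[r yr]].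
  by exists (d * p); rewrite !tofracM -xp; ring.
by exists (e * r); rewrite !tofracM -yr; ring.
Qed.

Lemma clear_denom m k (Y : 'M[Fq]_(m, k)) : exists2 d : {poly rat}, d != 0 &
  exists Z : 'M[{poly rat}]_(m, k), d%:F *: Y = map_mx tofracq Z.
Proof.
have [d d0 dP] := common_denom [seq Y ij.1 ij.2 | ij <- enum {: 'I_m * 'I_k}].
have {}dP ij : exists p, d%:F * Y ij.1 ij.2 == p%:F.
  have [|p pE] := dP (Y ij.1 ij.2); last by exists p; rewrite pE.
  by apply/mapP; exists ij; rewrite ?mem_enum.
exists d => //; exists (\matrix_(i, j) xchoose (dP (i, j))).
by apply/matrixP => i j; rewrite !mxE; apply/eqP/(xchooseP (dP (i, j))).
Qed.

(** After clearing denominators, divide by ['X - 1] as long as all entries vanish at 1. This ends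
    because the size of one nonzero entry drops each time. *)
Lemma specialize_neq0 m k (Y : 'M[Fq]_(m, k)) : Y != 0 ->
  exists c (Z : 'M[{poly rat}]_(m, k)),
    [/\ c != 0, c *: Y = map_mx tofracq Z & map_mx ev1 Z != 0].
Proof.
move=> Y0; have [d d0 [Z ZE]] := clear_denom Y.
have dF : d%:F != 0 by rewrite tofrac_eq0.
have /matrix0Pn[i [j Zij]] : Z != 0.
  apply: contraNneq Y0 => Z0; move/eqP: ZE.
  by rewrite Z0 map_mx0 scaler_eq0 (negbTE dF).
have [l] := ubnP (size (Z i j)); move: {d d0 dF} d%:F dF ZE Zij.
elim: l Z => // l IH Z c c0 ZE Zij le.
have [ev0|] := eqVneq (map_mx ev1 Z) 0; last by exists c, Z.
have root1 a b : Z a b = (Z a b %/ ('X - 1%:P)) * ('X - 1%:P).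
  rewrite divpK // dvdp_XsubCl; apply/rootP.
  by have /matrixP/(_ a b) := ev0; rewrite !mxE.
pose Z' := map_mx (fun p => p %/ ('X - 1%:P)) Z.
pose e := tofracq ('X - 1%:P).
have e0 : e != 0 by rewrite tofrac_eq0 polyXsubC_eq0.
apply: (IH Z' (e^-1 * c)).
- exact: (mulf_neq0 (invr_neq0 e0) c0).
- rewrite -scalerA ZE; apply/matrixP => a b; rewrite !mxE {1}root1 tofracM.
  by rewrite mulrC mulfK.
- by rewrite mxE; apply: contraNneq Zij => e1; rewrite root1 e1 mul0r.
have Z'0 : Z' i j != 0.
  by rewrite mxE; apply: contraNneq Zij => e1; rewrite root1 e1 mul0r.
have ZZ' : Z i j = Z' i j * ('X - 1%:P) by rewrite mxE -root1.
rewrite -ltnS; apply: leq_trans le.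
by rewrite ZZ' size_Mmonic ?monicXsubC // size_XsubC addn2.
Qed.

(** At each rational point every square vanishes, so a nonzero [p i] would have the roots
    [0, 1, ..., size (p i) - 1], one more than its degree. *)
Lemma poly_sum_sqr_eq0 (I : finType) (p : I -> {poly rat}) :
  \sum_i p i ^+ 2 = 0 -> forall i, p i = 0.
Proof.
move=> s0 i; apply/eqP; apply: contraT => pi0.
pose rs : seq rat := [seq k%:R | k <- iota 0 (size (p i))].
suff : (size rs < size (p i))%N by rewrite size_map size_iota ltnn.
apply: max_poly_roots => //.
  apply/allP => a _; rewrite rootE.
  have := congr1 (fun r => r.[a]) s0; rewrite horner_sum horner0 => /eqP.
  under eq_bigr => k _ do rewrite horner_exp.
  rewrite psumr_eq0 => [/allP/(_ i (mem_index_enum i))|k _]; last exact: sqr_ge0.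
  by rewrite /= sqrf_eq0.
by rewrite map_inj_uniq ?iota_uniq // => a b /eqP; rewrite eqr_nat => /eqP.
Qed.

Lemma Fq_anisotropic m (v : 'rV[Fq]_m) : v *m v^T = 0 -> v = 0.
Proof.
move=> vv; have [d d0 [Z ZE]] := clear_denom v.
have dF : d%:F != 0 by rewrite tofrac_eq0.
suff Z0 : Z = 0.
  apply/eqP; move/eqP: ZE; rewrite Z0 map_mx0 scaler_eq0 (negbTE dF) //.
have s0 : \sum_i Z 0 i ^+ 2 = 0.
  have : map_mx tofracq (Z *m Z^T) = 0.
    by rewrite map_mxM -map_trmx -ZE linearZ /= -scalemxAl -scalemxAr vv !scaler0.
  move/matrixP/(_ 0 0); rewrite !mxE => /eqP; rewrite tofrac_eq0 => /eqP e.
  by rewrite -[RHS]e; apply: eq_bigr => i _; rewrite mxE expr2.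
apply/rowP => i; rewrite mxE; exact: (poly_sum_sqr_eq0 s0).
Qed.

End Fractions.

(** * Families of symmetric matrices *)

Section SymmetricFamilies.
Local Open Scope ring_scope.
Variables (F : fieldType) (J : Type) (N : nat) (A : J -> 'M[F]_N).
Hypothesis aniso : forall m (v : 'rV[F]_m), v *m v^T = 0 -> v = 0.
Hypothesis symA : forall i, (A i)^T = A i.

Definition inv_sub m (U : 'M[F]_(m, N)) := forall i, (U *m A i <= U)%MS.

Definition irr_sub (U : 'M[F]_N) := [/\ inv_sub U, U != 0 &
  forall Y : 'M[F]_N, inv_sub Y -> (Y <= U)%MS -> Y = 0 \/ (U <= Y)%MS].

Definition orth (Y : 'M[F]_N) : 'M[F]_N := kermx Y^T.

Lemma orth_inv Y : inv_sub Y -> inv_sub (orth Y).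
Proof.
move=> invY i; apply/sub_kermxP; have /submxP[D DE] := invY i.
rewrite -mulmxA -{1}symA -trmx_mul DE trmx_mul mulmxA.
by rewrite (_ : orth Y *m Y^T = 0) ?mul0mx //; apply: mulmx_ker.
Qed.

Lemma cap_orth Y : (Y :&: orth Y)%MS = 0.
Proof.
apply/eqP/rowV0P => v; rewrite sub_capmx => /andP[/submxP[D DE] /sub_kermxP v0].
by apply: aniso; rewrite {2}DE trmx_mul mulmxA v0 mul0mx.
Qed.

Lemma add_orth Y : row_full (Y + orth Y)%MS.
Proof.
rewrite /row_full (mxrank_disjoint_sum (cap_orth Y)) mxrank_ker mxrank_tr.
by rewrite subnKC // rank_leq_row.
Qed.

Lemma decompose (U : 'M[F]_N) : inv_sub U ->
  exists s : seq 'M[F]_N, [/\ forall X, X \in s -> irr_sub X,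
    (\sum_(X <- s) X :=: U)%MS & (\sum_(X <- s) \rank X)%N = \rank U].
Proof.
have [m] := ubnP (\rank U); elim: m U => // m IH U le invU.
have [->|U0] := eqVneq U 0; first by exists [::]; rewrite !big_nil mxrank0.
have [irrU|red] := classic (irr_sub U).
  exists [:: U]; rewrite !big_seq1; split=> // X; by rewrite inE => /eqP->.
have [Y [invY YU Y0 UY]] : exists Y : 'M[F]_N,
    [/\ inv_sub Y, (Y <= U)%MS, Y != 0 & ~ (U <= Y)%MS].
  apply: NNPP => none; case: red; split=> // Y invY YU.
  have [Y0|Y0] := eqVneq Y 0; [by left | right].
  by apply: contraT => /negP nUY; case: none; exists Y.
(* By the modular law [Z] is an invariant complement of [Y] within [U]. *)
pose Z := (U :&: orth Y)%MS.
have invZ : inv_sub Z.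
  move=> i; rewrite sub_capmx.
  rewrite (submx_trans (submxMr _ (capmxSl _ _)) (invU i)) /=.
  exact: submx_trans (submxMr _ (capmxSr _ _)) (orth_inv invY i).
have YZ0 : (Y :&: Z)%MS = 0.
  apply/eqP; rewrite -submx0 -(cap_orth Y) capmxS ?submx_refl //.
  exact: capmxSr.
have YZ : (Y + Z :=: U)%MS.
  apply/eqmxP/andP; split; first by rewrite addsmx_sub YU capmxSl.
  rewrite /Z capmxC (matrix_modl _ YU) sub_capmx submx_refl andbT.
  by rewrite submx_full ?add_orth.
have rYZ : (\rank Y + \rank Z)%N = \rank U.
  by rewrite -(mxrank_disjoint_sum YZ0) YZ.
have rY0 : (0 < \rank Y)%N by rewrite lt0n mxrank_eq0.
have rYU : (\rank Y < \rank U)%N.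
  rewrite ltn_neqAle mxrankS // andbT; apply: contra_notN UY => /eqP e.
  by have := mxrank_leqif_sup YU => -[_]; rewrite e eqxx => <-.
have [|s1 [irr1 sum1 rk1]] := IH Y _ invY; first by lia.
have [|s2 [irr2 sum2 rk2]] := IH Z _ invZ; first by lia.
exists (s1 ++ s2); split.
- by move=> X; rewrite mem_cat => /orP[/irr1|/irr2].
- rewrite big_cat /=; apply: eqmx_trans YZ.
  exact: adds_eqmx.
by rewrite big_cat /= rk1 rk2.
Qed.

Definition subrep (U : 'M[F]_N) (i : J) : 'M[F]_(\rank U) :=
  row_base U *m A i *m pinvmx (row_base U).

Lemma subrepE U i : inv_sub U -> subrep U i *m row_base U = row_base U *m A i.
Proof.
move=> invU; rewrite /subrep mulmxKpV // eq_row_base.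
by rewrite (eqmxMr _ (eq_row_base U)) invU.
Qed.

Lemma subrep_irr (U : 'M[F]_N) (V : 'M[F]_(\rank U)) : irr_sub U ->
  (forall i, (V *m subrep U i <= V)%MS) -> \rank V = 0%N \/ \rank V = \rank U.
Proof.
move=> [invU U0 irrU] invV; pose Y := <<V *m row_base U>>%MS.
have rY : \rank Y = \rank V by rewrite genmxE mxrankMfree ?row_base_free.
have invY : inv_sub Y.
  move=> i; rewrite (eqmxMr _ (genmxE _)) genmxE -mulmxA -subrepE // mulmxA.
  exact: submxMr.
have YU : (Y <= U)%MS by rewrite genmxE (submx_trans (submxMl _ _)) ?eq_row_base.
case: (irrU Y invY YU) => [Y0|UY]; first by left; rewrite -rY Y0 mxrank0.
right; apply/eqP; rewrite -rY eqn_leq mxrankS //=; exact: mxrankS.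
Qed.

Lemma schur d (B : J -> 'M[F]_d) (U : 'M[F]_N) (G : 'M[F]_(\rank U, d)) :
  irr_sub U -> (0 < d)%N ->
  (forall V : 'M[F]_d, (forall i, (V *m B i <= V)%MS) ->
     \rank V = 0%N \/ \rank V = d) ->
  (forall i, subrep U i *m G = G *m B i) -> G != 0 -> row_free G /\ row_full G.
Proof.
move=> irrU d0 irrB hom G0; split.
  rewrite -kermx_eq0; have [|e|e] := @subrep_irr U (kermx G) irrU.
  - by move=> i; apply/sub_kermxP; rewrite -mulmxA hom mulmxA mulmx_ker mul0mx.
  - by rewrite -mxrank_eq0 e.
  case/eqP: G0; rewrite -[G]mul1mx; apply/sub_kermxP.
  by rewrite sub1mx /row_full e.
have rG : \rank <<G>>%MS = \rank G by rewrite genmxE.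
have [|e|e] := irrB <<G>>%MS.
- move=> i; rewrite (eqmxMr _ (genmxE _)) genmxE -hom; exact: submxMl.
- by move: G0; rewrite -mxrank_eq0 -rG e.
by rewrite /row_full -rG e.
Qed.

Lemma gram_unit r (R : 'M[F]_(r, N)) : row_free R -> R *m R^T \in unitmx.
Proof.
move=> fR; rewrite -row_free_unit -kermx_eq0; apply/rowV0P => v /sub_kermxP v0.
apply: (row_free_inj fR); rewrite mul0mx; apply: aniso.
by rewrite trmx_mul mulmxA -(mulmxA v) v0 mul0mx.
Qed.

Hypothesis symC : forall X : 'M[F]_N, (forall i, A i *m X = X *m A i) -> X^T = X.

(** The matrix [X] projects orthogonally onto [U], applies [Q] and embeds the result as [V], so it
    lies in the commutant. Its row space contains [V] and that of its transpose lies in [U];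
    symmetry identifies the two. *)
Lemma subrep_iso_le (U V : 'M[F]_N) (Q : 'M[F]_(\rank U, \rank V)) :
  inv_sub U -> inv_sub V -> row_full Q ->
  (forall i, subrep U i *m Q = Q *m subrep V i) -> (V <= U)%MS.
Proof.
move=> invU invV fQ hom.
set R := row_base U; set S := row_base V.
have fR : row_free R := row_base_free U.
pose G := R *m R^T; have uG : G \in unitmx := gram_unit fR.
have AR i : A i *m R^T = R^T *m (subrep U i)^T.
  by rewrite -{1}symA -trmx_mul -subrepE // trmx_mul.
have GW i : G *m (subrep U i)^T = subrep U i *m G.
  by rewrite /G -mulmxA -AR mulmxA -subrepE // mulmxA.
have WG i : (subrep U i)^T *m invmx G = invmx G *m subrep U i.
  by rewrite -[LHS](mulKmx uG) (mulmxA G) GW -(mulmxA _ G) mulmxV ?mulmx1.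
pose X := R^T *m invmx G *m Q *m S.
have /symC symX i : A i *m X = X *m A i.
  rewrite /X -[RHS]mulmxA -subrepE // !mulmxA AR.
  by rewrite -!mulmxA; congr (_ *m _); rewrite !mulmxA WG -(mulmxA (invmx G)) hom !mulmxA.
have SX : (S <= X)%MS.
  have RX : R *m X = Q *m S.
    by rewrite /X !mulmxA -/G mulmxV // mul1mx.
  apply: submx_trans (_ : (Q *m S <= X)%MS); last by rewrite -RX submxMl.
  by rewrite -{1}[S]mul1mx submxMr // submx_full.
have VS : (V <= S)%MS by rewrite eq_row_base.
apply: submx_trans VS (submx_trans SX _); rewrite -symX /X.
rewrite (trmx_mul _ S) (trmx_mul _ Q) (trmx_mul R^T) trmxK (mulmxA Q^T).
by rewrite (mulmxA S^T) (submx_trans (submxMl _ _)) // eq_row_base.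
Qed.

End SymmetricFamilies.

(** * Normal forms of words *)

Section NormalWords.
Local Open Scope ring_scope.
Variables (n d : nat) (A : 'I_n.-1 -> 'M[Fq]_d).
Hypothesis heckeA : is_hecke_rep A.

(** Natural indices allow arithmetic on generators; the bounds in the relations below keep the
    default 0 out of reach. *)
Let K (k : nat) : 'M[Fq]_d := if insub k is Some i then A i else 0.

Let KE (i : 'I_n.-1) : K i = A i.
Proof. by rewrite /K valK. Qed.

Let K_comm j k : (j.+1 < k)%N -> (k.+1 < n)%N -> K j *m K k = K k *m K j.
Proof.
move=> jk kn; have [_ com _] := heckeA.
have jn' : (j < n.-1)%N by lia.
have kn' : (k < n.-1)%N by lia.
have := com (Ordinal jn') (Ordinal kn'); rewrite -!KE /=; apply.
by rewrite jk.
Qed.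

Let K_braid k : (k.+2 < n)%N ->
  K k.+1 *m K k *m K k.+1 = K k *m K k.+1 *m K k.
Proof.
move=> kn; have [_ _ br] := heckeA.
have kn1 : (k < n.-1)%N by lia.
have kn2 : (k.+1 < n.-1)%N by lia.
by have := br (Ordinal kn1) (Ordinal kn2) erefl; rewrite -!KE /=.
Qed.

Let K_quad k : (k.+1 < n)%N -> K k *m K k = (1 - q) *: K k + q *: 1%:M.
Proof.
move=> kn; have [qd _ _] := heckeA.
have kn1 : (k < n.-1)%N by lia.
have := qd (Ordinal kn1); rewrite -!KE /= mulmxBr mulmx1 mulmxDl mul_scalar_mx.
move=> /eqP; rewrite subr_eq0 eq_sym -subr_eq => /eqP <-.
by apply/matrixP => a b; rewrite !mxE; ring.
Qed.

Fixpoint desc a c : 'M[Fq]_d := if c is c'.+1 then K (a + c') *m desc a c' else 1%:M.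

Lemma desc_recr a c : desc a c.+1 = desc a.+1 c *m K a.
Proof.
elim: c => [|c IH]; first by rewrite /= addn0 mulmx1 mul1mx.
by rewrite [LHS]/= -/(desc a c.+1) IH /= addSnnS mulmxA.
Qed.

Lemma desc_comm_lo a c i : (i.+1 < a)%N -> (a + c < n)%N ->
  desc a c *m K i = K i *m desc a c.
Proof.
move=> ia; elim: c => [|c IH] cn /=; first by rewrite mul1mx mulmx1.
rewrite -mulmxA IH; last by lia.
by rewrite !mulmxA (@K_comm i (a + c)) //; lia.
Qed.

Lemma desc_comm_hi a c j : (a + c < j)%N -> (j.+1 < n)%N ->
  desc a c *m K j = K j *m desc a c.
Proof.
move=> + jn; elim: c => [|c IH] cj /=; first by rewrite mul1mx mulmx1.
rewrite -mulmxA IH; last by lia.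
by rewrite !mulmxA K_comm //; lia.
Qed.

(** A generator of the run other than its last crosses it by one braid relation and commutations,
    losing 1 in its index. *)
Lemma desc_shift a c i : (a < i)%N -> (i < a + c)%N -> (a + c < n)%N ->
  desc a c *m K i = K i.-1 *m desc a c.
Proof.
move=> ai; elim: c => [|c IH] ic cn; first by lia.
have [lt|ge] := ltnP i (a + c).
  rewrite /= -mulmxA IH //; last by lia.
  by rewrite !mulmxA -K_comm //; lia.
case: c IH ic cn ge => [|c] _ ic cn ge; first by lia.
have {ic ge} -> : i = (a + c).+1 by lia.
rewrite /= addnS -!mulmxA desc_comm_hi //; try lia.
by rewrite !mulmxA K_braid //; lia.
Qed.

(** One descending run [K (m'-1) ... K a] per level, empty for [a = m']: these are coset
    representatives along the tower of symmetric groups. *)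
Fixpoint nwords m : seq 'M[Fq]_d := if m is m'.+1 then
  [seq X *m desc a (m' - a) | X <- nwords m', a <- iota 0 m] else [:: 1%:M].

Lemma size_nwords m : size (nwords m) = m`!.
Proof.
elim: m => //= m IH; rewrite (size_allpairs_dep _ _ (fun=> 0%N :: iota 1 m)) /= size_iota.
by rewrite factS -IH; elim: (nwords m) => [|X s /= ->]; rewrite ?muln0 // mulnS.
Qed.

Lemma span_mulmx (L L' : seq 'M[Fq]_d) (T : 'M[Fq]_d) :
  (forall X, X \in L -> X *m T \in <<L'>>%VS) ->
  forall Y, Y \in <<L>>%VS -> Y *m T \in <<L'>>%VS.
Proof.
move=> LT Y YL; rewrite (coord_span (X := in_tuple L) YL) mulmx_suml.
apply: memv_suml => i _; rewrite -scalemxAl memvZ // LT //.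
exact: mem_nth.
Qed.

Lemma nwords_S m a Y : (a <= m)%N -> Y \in <<nwords m>>%VS ->
  Y *m desc a (m - a) \in <<nwords m.+1>>%VS.
Proof.
move=> am; apply: span_mulmx => X XL; apply: memv_span.
have aL : a \in iota 0 m.+1 by rewrite mem_iota add0n ltnS.
by apply/allpairsPdep; exists X, a.
Qed.

(** Multiply a word with last run ending in [K a] by [K i]. For [i.+1 < a] or [i > a] a generator
    passes to the left of the run, where induction applies. For [i.+1 = a] the run grows by one; for
    [i = a] the quadratic relation yields the run itself and a shorter one. *)
Lemma nwords_closed m i : (m <= n)%N -> (i.+1 < m)%N ->
  forall Y, Y \in <<nwords m>>%VS -> Y *m K i \in <<nwords m>>%VS.
Proof.
elim: m i => // m IH i mn im; apply: span_mulmx.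
move=> _ /(@allpairsPdep _ _ _ _ _ (fun=> iota 0 m.+1))[X [a [XL aL ->]]].
have {aL} am : (a <= m)%N by move: aL; rewrite mem_iota add0n ltnS.
have XS : X \in <<nwords m>>%VS by apply: memv_span.
rewrite -mulmxA.
case: (ltngtP i a) => [lt|gt|e].
- have [lt1|ge1] := ltnP i.+1 a.
    rewrite desc_comm_lo //; last by lia.
    rewrite mulmxA; apply: nwords_S => //; apply: IH => //; lia.
  have ai : a = i.+1 by lia.
  have -> : desc a (m - a) *m K i = desc i (m - i).
    by rewrite ai -desc_recr; congr desc; lia.
  by apply: nwords_S => //; lia.
- rewrite desc_shift //; try lia.
  rewrite mulmxA; apply: nwords_S => //; apply: IH => //; lia.
have -> : (m - a = (m - a.+1).+1)%N by lia.
rewrite {i}e in im *; rewrite desc_recr -(mulmxA _ (K a)) K_quad; last by lia.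
rewrite mulmxDr -!scalemxAr mulmx1 -desc_recr mulmxDr -!scalemxAr.
apply: memvD; apply: memvZ.
  have -> : ((m - a.+1).+1 = m - a)%N by lia.
  exact: (nwords_S am XS).
have am1 : (a < m)%N by lia.
exact: (nwords_S am1 XS).
Qed.

Lemma nwords1 m : 1%:M \in nwords m.
Proof.
elim: m => [|m IH]; first by rewrite inE.
have mL : m \in iota 0 m.+1 by rewrite mem_iota add0n ltnSn.
by apply/allpairsPdep; exists 1%:M, m; rewrite subnn mulmx1.
Qed.

Lemma wmx_span s : wmx A s \in <<nwords n>>%VS.
Proof.
elim/last_ind: s => [|s i IH] /=; first by apply: memv_span; apply: nwords1.
rewrite -cats1 wmx_cat /= mulmx1 -KE; apply: nwords_closed => //.
by have := ltn_ord i; lia.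
Qed.

End NormalWords.

(** * The symmetrized model over Q(qhalf) *)

Section Generic.
Local Open Scope ring_scope.
Variable n : nat.

Notation N := (Nn n).
Notation tofracq := (@FracField.tofrac {poly rat}).
Notation ev1 := (horner_eval (1 : rat)).

Definition srho (i : 'I_n.-1) : 'M[Fq]_N := opmx q qhalf qhalf i.
Let P (i : 'I_n.-1) : 'M[{poly rat}]_N := opmx ('X ^+ 2) 'X 'X i.
Let M (i : 'I_n.-1) : 'M[rat]_N := opmx 1 1 1 i.

Let map_P i : map_mx tofracq (P i) = srho i.
Proof. by rewrite /P map_opmx rmorphXn. Qed.

Let map_M i : map_mx ev1 (P i) = M i.
Proof.
by rewrite /P map_opmx rmorphXn /= /horner_eval hornerX expr1n.
Qed.

Lemma srho_sym i : (srho i)^T = srho i.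
Proof. exact: opmx_sym. Qed.

Lemma map_tofrac_inj m k : injective (map_mx tofracq : 'M_(m, k) -> 'M_(m, k)).
Proof.
move=> X Y /matrixP XY; apply/matrixP => i j.
by have /eqP := XY i j; rewrite !mxE tofrac_eq => /eqP.
Qed.

(** The matrix [X - X^T] is antisymmetric and in the commutant. If it were nonzero, a multiple would
    specialize to a nonzero antisymmetric matrix of the commutant at 1, where all matrices are
    symmetric. *)
Lemma srho_comm_sym (X : 'M[Fq]_N) :
  (forall i, srho i *m X = X *m srho i) -> X^T = X.
Proof.
move=> comX; apply/eqP; rewrite eq_sym -subr_eq0; apply: contraT => Y0.
have [c [Z [c0 ZE Z1]]] := specialize_neq0 Y0.
have comXT i : srho i *m X^T = X^T *m srho i.
  by rewrite -{1}srho_sym -trmx_mul -comX trmx_mul srho_sym.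
have comZ i : P i *m Z = Z *m P i.
  apply: map_tofrac_inj; rewrite !map_mxM /= map_P -ZE -scalemxAr -scalemxAl.
  by rewrite mulmxBr mulmxBl comX comXT.
have ZT : Z^T = - Z.
  apply: map_tofrac_inj; rewrite map_mxN -map_trmx -ZE linearZ linearB /= trmxK.
  by rewrite -scalerN opprB.
pose Z' := map_mx ev1 Z.
have Z'T : Z'^T = Z'.
  apply: commutant_one_sym => i.
  by rewrite -/(M i) -map_M -!map_mxM comZ.
case/eqP: Z1; apply/matrixP => i j.
have /matrixP/(_ i j) : Z' = - Z' by rewrite -{1}Z'T /Z' map_trmx ZT map_mxN.
rewrite !mxE => /eqP; rewrite -subr_eq0 opprK -mulr2n mulrn_eq0 /=.
by move/eqP.
Qed.

Lemma map_mx_comb (R S : pzRingType) (f : {rmorphism R -> S}) (I : finType) m k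
    (c : I -> R) (Y : I -> 'M[R]_(m, k)) :
  map_mx f (\sum_g c g *: Y g) = \sum_g f (c g) *: map_mx f (Y g).
Proof.
apply/matrixP => i j; rewrite mxE !summxE rmorph_sum.
by apply: eq_bigr => g _; rewrite !mxE rmorphM.
Qed.

Lemma srho_words_free (c : 'S_n -> Fq) :
  \sum_g c g *: wmx srho (word g) = 0 -> forall g, c g = 0.
Proof.
move=> c0.
pose Y : 'rV[Fq]_#|{: 'S_n}| := \row_k c (enum_val k).
suff Y0 : Y = 0.
  move=> g; have /matrixP/(_ 0 (enum_rank g)) := Y0.
  by rewrite !mxE enum_rankK.
apply/eqP; apply: contraT => /specialize_neq0[e [Z [e0 ZE /eqP[]]]].
have sumZ : \sum_g Z 0 (enum_rank g) *: wmx P (word g) = 0.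
  apply: map_tofrac_inj; rewrite map_mx_comb map_mx0.
  transitivity (e *: \sum_g c g *: wmx srho (word g)); last by rewrite c0 scaler0.
  rewrite scaler_sumr.
  apply: eq_bigr => g _; rewrite map_wmx (eq_wmx _ map_P) scalerA.
  congr (_ *: _).
  by have /matrixP/(_ 0 (enum_rank g)) := ZE; rewrite !mxE enum_rankK.
have Z1 : \sum_g ev1 (Z 0 (enum_rank g)) *: wmx M (word g) = 0.
  have := congr1 (map_mx ev1) sumZ; rewrite map_mx_comb map_mx0 => e1.
  apply: etrans e1; apply: eq_bigr => g _.
  by rewrite map_wmx (eq_wmx _ map_M).
have := words_free_one Z1 => z; apply/rowP => k; rewrite !mxE.
by have := z (enum_val k); rewrite enum_valK.
Qed.

Lemma srho_hecke : is_hecke_rep srho.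
Proof.
have qq : qhalf * qhalf = q by rewrite /q expr2.
by split=> [i|i j|i j]; [exact: opmx_quadratic|exact: opmx_comm|exact: opmx_braid].
Qed.

Lemma rho_hecke : is_hecke_rep (@rho n).
Proof.
have qq : q * 1 = q by rewrite mulr1.
split=> [i|i j far|i j ji]; rewrite !rhoE.
- exact: opmx_quadratic.
- exact: opmx_comm.
exact: opmx_braid.
Qed.

Lemma mul_block_diag (R : pzRingType) m k (A A' : 'M[R]_m) (B B' : 'M[R]_k) :
  block_mx A 0 0 B *m block_mx A' 0 0 B' = block_mx (A *m A') 0 0 (B *m B').
Proof. by rewrite mulmx_block !(addr0, mulmx0, mul0mx, add0r). Qed.

Lemma ulsubmx_comb (R : pzRingType) (I : finType) m k (c : I -> R) (Y : I -> 'M[R]_(m + k)) :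
  ulsubmx (\sum_i c i *: Y i) = \sum_i c i *: ulsubmx (Y i).
Proof.
apply/matrixP => a b; rewrite !mxE !summxE.
by apply: eq_bigr => i _; rewrite !mxE.
Qed.

Lemma drsubmx_comb (R : pzRingType) (I : finType) m k (c : I -> R) (Y : I -> 'M[R]_(m + k)) :
  drsubmx (\sum_i c i *: Y i) = \sum_i c i *: drsubmx (Y i).
Proof.
apply/matrixP => a b; rewrite !mxE !summxE.
by apply: eq_bigr => i _; rewrite !mxE.
Qed.

Lemma ulsubmx0 (R : pzRingType) m k : ulsubmx (0 : 'M[R]_(m + k)) = 0.
Proof. by apply/matrixP => a b; rewrite !mxE. Qed.

Section Completeness.
Variables (d : nat) (C : 'I_n.-1 -> 'M[Fq]_d).
Hypotheses (heckeC : is_hecke_rep C) (d_gt0 : (0 < d)%N).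

Let K i : 'M[Fq]_(N + d) := block_mx (srho i) 0 0 (C i).

Let K_hecke : is_hecke_rep K.
Proof.
have [q1 c1 b1] := srho_hecke; have [q2 c2 b2] := heckeC.
split=> [i|i j far|i j ji].
- rewrite !scalar_mx_block opp_block_mx !add_block_mx mulmx_block.
  by rewrite !(oppr0, addr0, mulmx0, mul0mx, add0r) q1 q2 block_mx0.
- by rewrite !mul_block_diag (c1 i j far) (c2 i j far).
by rewrite !mul_block_diag (b1 i j ji) (b2 i j ji).
Qed.

Let wmxK s : wmx K s = block_mx (wmx srho s) 0 0 (wmx C s).
Proof.
elim: s => [|i s IH] /=; first by rewrite -scalar_mx_block.
by rewrite IH mul_block_diag.
Qed.

Let p := #|{: 'S_n}|.
Let X : p.-tuple 'M[Fq]_(N + d) := [tuple wmx K (word (enum_val i)) | i < p].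

Let X_free : free X.
Proof.
apply/freeP => c c0 k.
have: \sum_g c (enum_rank g) *: wmx srho (word g) = 0.
  have := congr1 ulsubmx c0; rewrite ulsubmx_comb ulsubmx0 => e.
  apply: etrans e; rewrite (reindex (@enum_val _ {: 'S_n})) /=; last first.
    by apply: onW_bij; exists enum_rank; [exact: enum_valK | exact: enum_rankK].
  apply: eq_bigr => i _; rewrite enum_valK (nth_map i) ?size_enum_ord //.
  by rewrite nth_ord_enum wmxK block_mxKul.
by move/srho_words_free/(_ (enum_val k)); rewrite enum_valK.
Qed.

Let X_span s : wmx K s \in <<X>>%VS.
Proof.
have -> : <<X>>%VS = <<nwords K n>>%VS; last exact: wmx_span.
apply/eqP; rewrite eqEdim; apply/andP; split.
  apply/span_subvP => Y /mapP[i _ ->]; exact: wmx_span.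
rewrite (eqP X_free) size_tuple /p.
apply: leq_trans (dim_span _) _; by rewrite size_nwords card_Sn.
Qed.

Lemma word_coefs s : exists r : 'rV[Fq]_p,
  (wmx srho s == \sum_k r 0 k *: wmx srho (word (enum_val k))) &&
  (wmx C s == \sum_k r 0 k *: wmx C (word (enum_val k))).
Proof.
have [f] : exists f : 'I_p -> Fq, wmx K s = \sum_k f k *: X`_k.
  by exists (fun k => coord X k (wmx K s)); exact: coord_span (X_span s).
have XE (k : 'I_p) : X`_k = wmx K (word (enum_val k)).
  by rewrite (nth_map k) ?size_enum_ord // nth_ord_enum.
move=> e; exists (\row_k f k); apply/andP; split; apply/eqP.
  have := congr1 ulsubmx e; rewrite wmxK block_mxKul ulsubmx_comb => ->.
  by apply: eq_bigr => k _; rewrite XE wmxK block_mxKul mxE.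
have := congr1 drsubmx e; rewrite wmxK block_mxKdr drsubmx_comb => ->.
by apply: eq_bigr => k _; rewrite XE wmxK block_mxKdr mxE.
Qed.

End Completeness.
End Generic.

(** * A nonzero intertwiner out of the model *)

Section Intertwiner.
Local Open Scope ring_scope.
Variables (F : fieldType) (J : Type) (N d p : nat).
Variables (A : J -> 'M[F]_N) (C : J -> 'M[F]_d) (R : J -> 'M[F]_p).
Variables (S : 'I_p -> 'M[F]_N) (Phi : 'M[F]_(p, d)).
Hypothesis aniso : forall m (v : 'rV[F]_m), v *m v^T = 0 -> v = 0.
Hypothesis symA : forall i, (A i)^T = A i.
Hypothesis freeS : forall v : 'rV[F]_p, \sum_k v 0 k *: S k = 0 -> v = 0.
Hypothesis SA : forall i k, S k *m A i = \sum_l R i k l *: S l.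
Hypothesis PhiC : forall i, R i *m Phi = Phi *m C i.

(** For each [r] this intertwines [R], right multiplication in the basis [S], with [A]. *)
Let Psi r : 'M[F]_(p, N) := \matrix_k row r (S k).

Let PsiA i r : Psi r *m A i = R i *m Psi r.
Proof.
apply/row_matrixP => k; rewrite row_mul rowK -row_mul SA.
apply/rowP => j; rewrite !mxE summxE; apply: eq_bigr => l _.
by rewrite !mxE.
Qed.

Let G := \sum_r Psi r *m (Psi r)^T.

Let G_comm i : R i *m G = G *m (R i)^T.
Proof.
rewrite mulmx_sumr mulmx_suml; apply: eq_bigr => r _.
by rewrite mulmxA -PsiA -!mulmxA -trmx_mul -PsiA trmx_mul symA.
Qed.

(** The form [v *m G *m v^T] is the sum of the squares of all entries of [\sum_k v 0 k *: S k]. *)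
Let G_unit : G \in unitmx.
Proof.
rewrite -row_free_unit -kermx_eq0; apply/rowV0P => v /sub_kermxP v0.
pose Y := \sum_k v 0 k *: S k.
have rowY r : v *m Psi r = row r Y.
  apply/rowP => j; rewrite !mxE summxE; apply: eq_bigr => k _.
  by rewrite !mxE.
apply: freeS; rewrite -/Y; apply: (can_inj mxvecK); rewrite [RHS]linear0.
apply: aniso; have <- : v *m G *m v^T = 0 by rewrite v0 mul0mx.
rewrite mulmx_sumr mulmx_suml; apply/matrixP => a b; rewrite !ord1 summxE.
transitivity (\sum_r \sum_j Y r j * Y r j); last first.
  apply: eq_bigr => r _; rewrite mulmxA -mulmxA -trmx_mul rowY mxE.
  by apply: eq_bigr => j _; rewrite [RHS]mulrC !mxE.
rewrite mxE (reindex _ (curry_mxvec_bij _ _)) pair_bigA /=.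
by apply: eq_bigr => -[r j] _ /=; rewrite [X in _ * X]mxE mxvecE.
Qed.

(** Every [X r] intertwines [A] with [C], as [invmx G] turns the transpose of [R] back into [R]. The
    sum of the [Psi r *m X r] is [Phi], so some [X r] is nonzero. *)
Lemma intertwiner_exists : Phi != 0 ->
  exists2 X : 'M[F]_(N, d), X != 0 & forall i, A i *m X = X *m C i.
Proof.
move=> Phi0; pose X r := (Psi r)^T *m invmx G *m Phi.
have [r Xr|X0] := pickP (fun r => X r != 0).
  exists (X r) => // i; rewrite /X -[RHS]mulmxA -PhiC !mulmxA; congr (_ *m _).
  rewrite -{1}symA -trmx_mul PsiA trmx_mul -!mulmxA; congr (_ *m _).
  by rewrite -[LHS](mulKmx G_unit) (mulmxA G) -G_comm -(mulmxA _ G) mulmxV ?mulmx1.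
case/eqP: Phi0; rewrite -[Phi](mulKVmx G_unit) mulmx_suml big1 // => r _.
by have /negbFE/eqP := X0 r; rewrite /X -!mulmxA => ->; rewrite mulmx0.
Qed.

End Intertwiner.

Section Exists.
Local Open Scope ring_scope.
Variables (n d : nat) (C : 'I_n.-1 -> 'M[Fq]_d).
Hypotheses (heckeC : is_hecke_rep C) (d_gt0 : (0 < d)%N).

Lemma srho_hom_exists : exists2 X : 'M[Fq]_(Nn n, d),
  X != 0 & forall i, srho i *m X = X *m C i.
Proof.
pose w (k : 'I_#|{: 'S_n}|) := word (enum_val k).
pose r s := xchoose (word_coefs heckeC s).
have rE s : wmx (@srho n) s = \sum_k r s 0 k *: wmx (@srho n) (w k).
  by have /andP[/eqP] := xchooseP (word_coefs heckeC s).
have rC s : wmx C s = \sum_k r s 0 k *: wmx C (w k).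
  by have /andP[_ /eqP] := xchooseP (word_coefs heckeC s).
(* [Phi] sends [T_g] to the image of [b] under [T_g]. It is nonzero because the identity is a
   combination of the [T_g] and [b != 0]. *)
pose b : 'rV[Fq]_d := const_mx 1.
pose Phi : 'M[Fq]_(_, d) := \matrix_k (b *m wmx C (w k)).
apply: (@intertwiner_exists Fq _ _ _ _ (@srho n) C
  (fun i => \matrix_k r (w k ++ [:: i])) (fun k => wmx (@srho n) (w k)) Phi).
- exact: Fq_anisotropic.
- exact: srho_sym.
- move=> v v0; apply/rowP => k; rewrite [RHS]mxE -(enum_valK k).
  apply: (srho_words_free (c := fun g => v 0 (enum_rank g))).
  apply: etrans v0; rewrite (reindex (@enum_val _ {: 'S_n})) /=.
    by apply: eq_bigr => l _; rewrite enum_valK.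
  by apply: onW_bij; exists enum_rank; [exact: enum_valK | exact: enum_rankK].
- move=> i k; have := rE (w k ++ [:: i]); rewrite wmx_cat /= mulmx1 => ->.
  by apply: eq_bigr => l _; rewrite mxE.
- move=> i; apply/row_matrixP => k; rewrite !row_mul !rowK -mulmxA.
  have := rC (w k ++ [:: i]); rewrite wmx_cat /= mulmx1 => ->.
  rewrite mulmx_sumr mulmx_sum_row; apply: eq_bigr => l _.
  by rewrite rowK -scalemxAr.
apply/eqP => Phi0; have : b = 0.
  rewrite -[b]mulmx1 -[1%:M]/(wmx C [::]) rC mulmx_sumr big1 // => k _.
  have /row_matrixP/(_ k) := Phi0; rewrite rowK row0 -scalemxAr => ->.
  by rewrite scaler0.
move/matrixP/(_ 0 (Ordinal d_gt0)); rewrite !mxE => /eqP.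
by rewrite oner_eq0.
Qed.

End Exists.

(** * Equivalences of Hecke representations *)

Section Equivalences.
Local Open Scope ring_scope.
Variable n : nat.

Lemma hecke_pullback d e (A : 'I_n.-1 -> 'M[Fq]_d) (B : 'I_n.-1 -> 'M[Fq]_e)
    (R : 'M_(e, d)) :
  row_free R -> (forall i, B i *m R = R *m A i) -> is_hecke_rep A -> is_hecke_rep B.
Proof.
move=> fR BR [qd com br]; split=> [i|i j far|i j ji]; apply: (row_free_inj fR).
- rewrite mul0mx -mulmxA mulmxBl BR mul1mx -[X in _ - X]mulmx1 -mulmxBr mulmxA.
  by rewrite mulmxDl BR mul_scalar_mx -mul_mx_scalar -mulmxDr -mulmxA qd mulmx0.
- by rewrite -!mulmxA !BR !mulmxA !BR -!mulmxA (com i j far).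
have BBR k l m : B k *m B l *m B m *m R = R *m (A k *m A l *m A m).
  by rewrite -mulmxA BR mulmxA -(mulmxA (B k)) BR mulmxA BR !mulmxA.
by rewrite !BBR (br i j ji).
Qed.

Lemma hecke_equiv_sym d e (A : 'I_n.-1 -> 'M[Fq]_d) (B : 'I_n.-1 -> 'M[Fq]_e) :
  hecke_equiv A B -> hecke_equiv B A.
Proof.
move=> [P [fP uP AP]]; exists (pinvmx P); split.
- by apply/row_freeP; exists P; rewrite mulVpmx.
- by apply/row_fullP; exists P; rewrite mulmxVp.
move=> i; rewrite -[LHS]mul1mx -(mulVpmx uP) -mulmxA; congr (_ *m _).
by rewrite mulmxA -AP -mulmxA mulmxVp // mulmx1.
Qed.

Lemma hecke_equiv_trans d e f (A : 'I_n.-1 -> 'M[Fq]_d)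
    (B : 'I_n.-1 -> 'M[Fq]_e) (C : 'I_n.-1 -> 'M[Fq]_f) :
  hecke_equiv A B -> hecke_equiv B C -> hecke_equiv A C.
Proof.
move=> [P [fP uP AP]] [Q [fQ uQ BQ]]; exists (P *m Q); split.
- by rewrite /row_free mxrankMfree.
- have /row_fullP[P' P'P] := uP; have /row_fullP[Q' Q'Q] := uQ.
  by apply/row_fullP; exists (Q' *m P'); rewrite mulmxA -(mulmxA Q') P'P mulmx1.
by move=> i; rewrite mulmxA AP -mulmxA BQ mulmxA.
Qed.

Lemma rho_equiv_srho : hecke_equiv (@rho n) (@srho n).
Proof.
apply: hecke_equiv_sym; exists (ell_diag n); split=> [||i].
- by rewrite row_free_unit ell_diag_unit.
- by rewrite row_full_unit ell_diag_unit.
by rewrite /srho -ell_diag_rho.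
Qed.

End Equivalences.

Theorem theorem1p3 (n : nat) :
  is_hecke_rep (@rho n) /\
  exists (k : nat) (dims : 'I_k -> nat)
         (W : forall j : 'I_k, 'I_n.-1 -> 'M[Fq]_(dims j)),
    [/\ forall j, is_hecke_rep (W j) /\ hecke_irr (W j),
        forall j j' : 'I_k, j != j' -> ~ hecke_equiv (W j) (W j'),
        forall (d : nat) (B : 'I_n.-1 -> 'M[Fq]_d),
          is_hecke_rep B -> hecke_irr B -> exists j, hecke_equiv B (W j)
      & hecke_equiv (@rho n) (fun i => mxdiag (fun j => W j i))].
Proof.
split; first exact: rho_hecke.
have inv1 : inv_sub (@srho n) 1%:M%R by move=> i; rewrite submx1.
have [s [irr_s sum_s rank_s]] := decompose Fq_anisotropic (@srho_sym n) inv1.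
pose U (j : 'I_(size s)) := nth 0%R s j.
have irrU j : irr_sub (@srho n) (U j) by apply: irr_s; rewrite mem_nth.
have invU j : inv_sub (@srho n) (U j) by have [] := irrU j.
have sumU : (1%:M%R <= \sum_j U j)%MS.
  by rewrite -sum_s (big_nth 0%R) big_mkord.
have rankU : (\sum_j \rank (U j))%N = Nn n.
  by have := rank_s; rewrite mxrank1 (big_nth 0%R) big_mkord.
(* The ranks add up to the whole dimension, so the sum is direct and no summand contains another, as
   [subrep_iso_le] would force for isomorphic ones. *)
have dxU j j' : j != j' -> ~ (U j' <= U j)%MS.
  have /mxdirect_sumsP dx : mxdirect (\sum_j U j).
    rewrite mxdirectE /= rankU; apply/eqP/eqP; rewrite eqn_leq rank_leq_row.
    by rewrite -{1}(mxrank1 Fq (Nn n)) mxrankS.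
  move=> jj' le; have [_ Uj' _] := irrU j'; case/eqP: Uj'; apply/eqP.
  rewrite -submx0 -(dx j' isT) sub_capmx submx_refl /=.
  by apply: submx_trans le _; rewrite (sumsmx_sup j).
have hom j i : (subrep (@srho n) (U j) i *m row_base (U j) =
    row_base (U j) *m srho i)%R by apply: subrepE.
exists (size s), (fun j => \rank (U j)), (fun j => subrep (@srho n) (U j)).
split.
- move=> j; split; first exact: hecke_pullback (row_base_free _) (hom j) (@srho_hecke n).
  split; first by have [_ U0 _] := irrU j; rewrite lt0n mxrank_eq0.
  by move=> V; apply: subrep_irr.
- move=> j j' jj' [Q [_ fQ QW]]; apply: (dxU j j' jj').
  exact: (subrep_iso_le Fq_anisotropic (@srho_sym n) (@srho_comm_sym n)) QW.
- move=> d B heckeB [d_gt0 irrB].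
  have [X X0 homX] := srho_hom_exists heckeB d_gt0.
  (* The [U j] span the space, so [X] is nonzero on one of them, and Schur's lemma makes that
     restriction an equivalence. *)
  have [j Xj|none] := pickP (fun j => row_base (U j) *m X != 0)%R.
    exists j; apply: hecke_equiv_sym; exists (row_base (U j) *m X)%R.
    have homj i : (subrep (@srho n) (U j) i *m (row_base (U j) *m X) =
       row_base (U j) *m X *m B i)%R by rewrite mulmxA hom -!mulmxA homX.
    by have [] := schur (irrU j) d_gt0 irrB homj Xj.
  case/eqP: X0; rewrite -[X]mul1mx; apply/sub_kermxP.
  apply: submx_trans sumU _; apply/sumsmx_subP => j _.
  by rewrite -eq_row_base; apply/sub_kermxP; have /negbFE/eqP := none j.
apply: hecke_equiv_trans (rho_equiv_srho n) (hecke_equiv_sym _).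
pose P := (\mxcol_j row_base (U j))%R.
have fullP : row_full P.
  rewrite -sub1mx (submx_trans sumU) //; apply/sumsmx_subP => j _.
  by rewrite eqmx_col (sumsmx_sup j) // genmxE eq_row_base.
exists P; split=> // [|i].
  by apply/eqP; rewrite [RHS]rankU; exact/eqP.
rewrite /P mul_mxdiag_mxcol mxcol_mul; apply: eq_mxcol => j.
exact: hom.
Qed.
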